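(* Let $S_t$, $t\in\mathbb{R}$, denote the solution map for Yudovich solutions of the 2D incompressible Euler equations in the whole plane $\mathbb{R}^2$, defined on the space $L^\infty_c(\mathbb{R}^2)$ of compactly supported $L^\infty(\mathbb{R}^2)$ functions. Assume that $\omega_0\in L^\infty_c(\mathbb{R}^2)$, that the sequence $(\omega_0^n)_n\subset L^\infty_c(\mathbb{R}^2)$ is bounded in $L^1(\mathbb{R}^2)$, and that $\omega_0^n\overset{\ast}{\rightharpoonup}\omega_0$ in $L^\infty(\mathbb{R}^2)$. Then $S_\cdot(\omega_0^n)\overset{\ast}{\rightharpoonup}S_\cdot(\omega_0)$ in $L^\infty(\mathbb{R}^2\times(-T,T))$ for all $T>0$, and $S_t(\omega_0^n)\overset{\ast}{\rightharpoonup}S_t(\omega_0)$ in $L^\infty(\mathbb{R}^2)$ for all $t\in\mathbb{R}$.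
   Context: The 2D incompressible Euler equations in vorticity form on $\mathbb{R}^2$ are $\partial_t\omega+u\cdot\nabla\omega=0$, where the velocity is recovered by the Biot–Savart law $u=K*\omega$, $K*\omega(x)=\int_{\mathbb{R}^2}K(x-y)\omega(y)\,dy$, with $K(x)=\frac{(-x_2,x_1)}{2\pi|x|^2}$. $L^\infty_c(\mathbb{R}^2)$ is the space of $L^\infty(\mathbb{R}^2)$ functions with compact support. Yudovich solution: given $\omega_0\in L^\infty_c(\mathbb{R}^2)$, it is a triple $(\omega,u,X_t)$ with $\omega\in L^\infty(\mathbb{R};L^\infty(\mathbb{R}^2))$, $\omega(t)\in L^\infty_c(\mathbb{R}^2)$ for each $t$, $u(t)=K*\omega(t)$, $X_t:\mathbb{R}^2\to\mathbb{R}^2$ measure-preserving and invertible, $\frac{d}{dt}X_t(x)=u(X_t(x),t)$, $X_0(x)=x$ for all $x\in\mathbb{R}^2$, and $\omega(x,t)=\omega_0(X_t^{-1}(x))$. It is a known theorem (Yudovich; Marchioro–Pulvirenti) that for each $\omega_0\in L^\infty_c(\mathbb{R}^2)$ there exists a unique such triple, and that $X_t$ is locally Hölder continuous with exponent $\exp(-C|t|(\|\omega_0\|_{L^1(\mathbb{R}^2)}+\|\omega_0\|_{L^\infty(\mathbb{R}^2)}))$ for a universal constant $C$. The solution map is $S_t(\omega_0)=\omega(t)$ (the function $x\mapsto\omega_0(X_t^{-1}(x))$), where $(\omega,u,X_t)$ is the Yudovich solution with initial data $\omega_0\in L^\infty_c(\mathbb{R}^2)$; $S_\cdot(\omega_0)$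 denotes the space-time function $(x,t)\mapsto S_t(\omega_0)(x)=\omega(x,t)$. The symbol $\overset{\ast}{\rightharpoonup}$ denotes weak-$*$ convergence in $L^\infty=(L^1)^*$: $f_n\overset{\ast}{\rightharpoonup}f$ in $L^\infty(E)$ iff $\int_E f_n g\to\int_E f g$ for all $g\in L^1(E)$. *)

(* Defs.v *)
From HB Require Import structures.
From mathcomp Require Import all_boot all_order all_algebra.
From mathcomp Require Import all_classical all_reals all_analysis.

Set Implicit Arguments.
Unset Strict Implicit.
Unset Printing Implicit Defensive.

Import Order.TTheory GRing.Theory Num.Theory.
Import numFieldNormedType.Exports.

Local Open Scope classical_set_scope.
Local Open Scope ring_scope.

(* Elements of Lebesgue spaces are handled through Borel representatives, and
   equality of two elements is equality almost everywhere. *)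

Notation plane R := (R * R)%type.

Notation leb2 R := (@lebesgue_measure R \x @lebesgue_measure R)%E.

(* Points of space-time are pairs (x, t) with x in the plane and t a time. *)
Notation leb2t R :=
  ((@lebesgue_measure R \x @lebesgue_measure R) \x @lebesgue_measure R)%E.

(* The compact support is the support of the class: f vanishes almost
   everywhere outside some compact set. *)
Definition Linfty_c (R : realType) (f : plane R -> R) : Prop :=
  f \in Lfun (leb2 R) +oo%E /\
  exists2 C : set (plane R), compact C &
    {ae leb2 R, forall x, ~ C x -> f x = 0}.

(* At the origin the kernel takes the value 0, because 0^-1 = 0. *)
Definition biot_savart_kernel (R : realType) (x : plane R) : plane R :=
  let d := 2 * pi * (x.1 ^+ 2 + x.2 ^+ 2) in (- x.2 / d, x.1 / d).

Definition biot_savart (R : realType) (w : plane R -> R) (x : plane R) :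
    plane R :=
  (\int[leb2 R]_(y in [set: plane R])
      ((biot_savart_kernel (x - y)).1 * w y),
   \int[leb2 R]_(y in [set: plane R])
      ((biot_savart_kernel (x - y)).2 * w y)).

(* The space L^oo(R; L^oo(R^2)). Measurability in time is understood as joint
   measurability in (x, t): a vorticity patch that moves is in general not
   strongly measurable as a map from R to the nonseparable space L^oo(R^2). *)
Definition Linfty_Linfty (R : realType) (w : R -> plane R -> R) : Prop :=
  measurable_fun [set: plane R * R] (fun p => w p.2 p.1) /\
  ('N[@lebesgue_measure R]_+oo[(fun t => 'N[leb2 R]_+oo[EFin \o w t])]
     < +oo)%E.

Definition measure_preserving d (T : measurableType d) (R : realType)
    (mu : {measure set T -> \bar R}) (F : T -> T) : Prop :=
  measurable_fun setT F /\
  forall A, measurable A -> mu (F @^-1` A) = mu A.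

Record yudovich_solution (R : realType) (w0 : plane R -> R)
    (w : R -> plane R -> R) (u X : R -> plane R -> plane R) : Prop := {
  yudovich_bounded : Linfty_Linfty w ;
  yudovich_Linfty_c : forall t, Linfty_c (w t) ;
  yudovich_velocity : forall t x, u t x = biot_savart (w t) x ;
  yudovich_measure_preserving : forall t, measure_preserving (leb2 R) (X t) ;
  yudovich_flow : forall t x,
    is_derive t (1 : R) (fun s => X s x) (u t (X t x)) ;
  yudovich_init : forall x, X 0 x = x ;
  (* Y is the two-sided inverse of X t, which is thereby asserted to exist *)
  yudovich_transport : forall t, exists Y : plane R -> plane R,
    [/\ cancel (X t) Y, cancel Y (X t) &
        {ae leb2 R, forall x, w t x = w0 (Y x)}]
}.

Definition solution_map (R : realType)
    (S : R -> (plane R -> R) -> plane R -> R) : Prop :=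
  forall w0, Linfty_c w0 ->
    exists u X, yudovich_solution w0 (fun t => S t w0) u X.

Definition weak_star_cvg d (T : measurableType d) (R : realType)
    (mu : {measure set T -> \bar R}) (E : set T)
    (f : nat -> T -> R) (f0 : T -> R) : Prop :=
  forall g : T -> R, mu.-integrable E (EFin \o g) ->
    (fun n => \int[mu]_(x in E) (f n x * g x)) @ \oo -->
      \int[mu]_(x in E) (f0 x * g x).

(* Main.v *)
(** Along trajectories the solution is w(t) = w0 o X_t^-1 and its velocity is the
    integral of K(x - X_t(y)) w0(y), so the weak-star convergence of the solutions
    follows from the weak-star convergence of the data as soon as the flows X_n
    converge pointwise to X. The data are bounded in L^oo by uniform boundedness,
    and the difference of two flows obeys a Gronwall inequality with a log-Lipschitz
    modulus and a source: the velocity at X_t(x) that the map X_t transports from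
    w0n - w0. This source tends to 0 uniformly on compact sets, because the kernel
    is locally integrable, decays at infinity, and the data are bounded in L^1.
    Comparing with the given flow X makes both compactness and uniqueness of the
    limit unnecessary. *)

Require Import Defs.
From HB Require Import structures.
From mathcomp Require Import all_boot all_order all_algebra finmap.
From mathcomp Require Import all_classical all_reals all_analysis.
From mathcomp Require Import measurable_realfun ess_sup_inf ring lra.
Set Implicit Arguments.
Unset Strict Implicit.
Unset Printing Implicit Defensive.
Import Order.TTheory GRing.Theory Num.Theory.
Import numFieldNormedType.Exports.
Local Open Scope classical_set_scope.
Local Open Scope ring_scope.

(** * The Biot-Savart kernel *)

(** The log-Lipschitz modulus is never written as [d * log (1 / d)]. The kernel is split at the
    dyadic scale [2 ^ -l], which gives for each [l] a linear inequality with Lipschitz constant O(l)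
    and error O(2 ^ -l). Gronwall multiplies this error by exp(O(l) t), harmless only for short [t];
    the admissible length depends on the bounds of the data alone, so finitely many steps reach any
    time. Space is unbounded and the supports of the data are not controlled, so closeness of the
    flows is measured against the weight [1 + |x| / L], with [L] enlarged at every step. Pointwise
    convergence of the flows does not by itself give convergence of [g o X_n] for a merely
    integrable [g]. Measure preservation fills the gap: it is enough to treat indicators, first of
    sets with negligible boundary, where pointwise convergence can be used, then of all Borel sets
    of finite measure. *)

Lemma plane_normE (R : realType) (p : plane R) :
  `|p| = Num.max `|p.1| `|p.2|.
Proof. by rewrite prod_normE. Qed.

Lemma plane_norm_fst (R : realType) (p : plane R) : `|p.1| <= `|p|.
Proof. by rewrite plane_normE le_max lexx. Qed.

Lemma plane_norm_snd (R : realType) (p : plane R) : `|p.2| <= `|p|.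
Proof. by rewrite plane_normE le_max lexx orbT. Qed.

Lemma plane_norm_le (R : realType) (p : plane R) (r : R) :
  (`|p| <= r) = (`|p.1| <= r) && (`|p.2| <= r).
Proof. by rewrite plane_normE ge_max. Qed.

(** Boxes are the balls of the product norm, whereas the kernel is built on the Euclidean norm; this
    bound and the next one pass between the two at the price of a factor 2. *)
Lemma plane_norm_sq_le (R : realType) (p : plane R) :
  `|p| ^+ 2 <= p.1 ^+ 2 + p.2 ^+ 2.
Proof.
rewrite plane_normE; case: (leP `|p.1| `|p.2|) => _;
  by rewrite real_normK ?num_real// (lerDl, lerDr) sqr_ge0.
Qed.

Lemma plane_norm_sq_ge (R : realType) (p : plane R) :
  p.1 ^+ 2 + p.2 ^+ 2 <= 2 * `|p| ^+ 2.
Proof.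
rewrite mulr2n mulrDl mul1r; apply: lerD; rewrite -real_normK ?num_real// lerXn2r//
  ?nnegrE ?plane_norm_fst ?plane_norm_snd//.
Qed.

Lemma kernel_le (R : realType) (p : plane R) :
  `|(biot_savart_kernel p).1| <= `|p|^-1 /\ `|(biot_savart_kernel p).2| <= `|p|^-1.
Proof.
have [p0|p0] := eqVneq `|p| 0.
  move/eqP: p0; rewrite normr_eq0 => /eqP ->.
  by rewrite /biot_savart_kernel /= oppr0 !mul0r normr0 invr_ge0.
have p_gt0 : 0 < `|p| by rewrite lt0r p0 normr_ge0.
have := plane_norm_sq_le p; set P := _ + _ => hP.
have P0 : 0 < P by rewrite (lt_le_trans _ hP)// exprn_gt0.
have pi2 := @pi_ge2 R.
have aux (a : R) : `|a| <= `|p| -> `|a / (2 * pi * P)| <= `|p|^-1.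
  move=> ha; rewrite normrM normfV ler_pdivrMr; last first.
    by rewrite normr_gt0; apply: lt0r_neq0; rewrite !mulr_gt0// pi_gt0.
  rewrite (@ger0_norm _ (2 * pi * P)) ?mulr_ge0 ?pi_ge0 ?(ltW P0)//.
  rewrite [leRHS]mulrC ler_pdivlMr//.
  apply: (le_trans (y := `|p| ^+ 2)).
    by rewrite expr2 ler_pM.
  apply: (le_trans hP); rewrite ler_peMl ?(ltW P0)//; lra.
by split; apply: aux; rewrite ?normrN ?plane_norm_fst ?plane_norm_snd.
Qed.

(** Up to a rotation and the factor [1 / (2 * pi)] the kernel is the inversion [p / |p| ^ 2], for
    which the Euclidean norm satisfies the identity [|K p - K q| = |p - q| / (2 * pi * |p| * |q|)].
    The factor 2 lost in the change of norm is absorbed by [(2 * pi) ^ 2 >= 2]. *)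
Lemma kernel_diff (R : realType) (p q : plane R) : p != 0 -> q != 0 ->
  `|(biot_savart_kernel p).1 - (biot_savart_kernel q).1| <= `|p - q| / (`|p| * `|q|) /\
  `|(biot_savart_kernel p).2 - (biot_savart_kernel q).2| <= `|p - q| / (`|p| * `|q|).
Proof.
move=> p0 q0.
have pp : 0 < `|p| by rewrite normr_gt0.
have qq : 0 < `|q| by rewrite normr_gt0.
have pi2 := @pi_ge2 R.
have hP := plane_norm_sq_le p; have hQ := plane_norm_sq_le q.
have hD := plane_norm_sq_ge (p - q).
rewrite /biot_savart_kernel /=.
move: hP hQ hD; rewrite /=.
set P := _ + _; set Q := _ + _ => hP hQ hD.
have P0 : 0 < P by rewrite (lt_le_trans _ hP)// exprn_gt0.
have Q0 : 0 < Q by rewrite (lt_le_trans _ hQ)// exprn_gt0.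
have PQ : (`|p| * `|q|) ^+ 2 <= P * Q by rewrite exprMn ler_pM ?exprn_ge0.
set A := (- p.2 / _ - _); set B := (p.1 / _ - _).
have E : A ^+ 2 + B ^+ 2 =
    ((p.1 - q.1) ^+ 2 + (p.2 - q.2) ^+ 2) / ((2 * pi) ^+ 2 * (P * Q)).
  by rewrite /A /B /P /Q; field; rewrite -/P -/Q; do !(apply/andP; split); lra.
have AB : A ^+ 2 + B ^+ 2 <= (`|p - q| / (`|p| * `|q|)) ^+ 2.
  rewrite E expr_div_n ler_pdivrMr; last by rewrite mulr_gt0 ?exprn_gt0 ?mulr_gt0//; lra.
  rewrite mulrAC ler_pdivlMr ?exprn_gt0 ?mulr_gt0//.
  have h4 : 2 <= (2 * pi : R) ^+ 2 by nra.
  apply: (le_trans (ler_pM _ _ hD PQ)); rewrite ?addr_ge0 ?sqr_ge0 ?exprn_ge0//.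
  rewrite -subr_ge0 (_ : _ - _ = `|p - q| ^+ 2 * (P * Q) * ((2 * pi) ^+ 2 - 2)); last by ring.
  by rewrite mulr_ge0 ?subr_ge0// mulr_ge0 ?exprn_ge0// ltW// mulr_gt0.
have nn : 0 <= `|p - q| / (`|p| * `|q|) by rewrite divr_ge0// mulr_ge0.
have fin (x : R) : x ^+ 2 <= (`|p - q| / (`|p| * `|q|)) ^+ 2 -> `|x| <= `|p - q| / (`|p| * `|q|).
  by rewrite -[x ^+ 2]real_normK ?num_real// ler_pXn2r// nnegrE.
by split; apply: fin; apply: le_trans AB; rewrite ?lerDl ?lerDr sqr_ge0.
Qed.

Lemma expr_small (R : realType) (q e : R) : 0 <= q -> q < 1 -> 0 < e ->
  exists n, q ^+ n <= e.
Proof.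
move=> q0 q1 e0; have : \forall n \near \oo, `|q ^+ n| <= e.
  by apply: cvgr0_norm_le => //; apply: cvg_expr; rewrite ger0_norm.
case=> n _ /(_ n (leqnn _)) /=; rewrite ger0_norm ?exprn_ge0// => h.
by exists n.
Qed.

Definition half_pow (R : realType) (l : nat) : R := 2^-1 ^+ l.

Definition box (R : realType) (r : R) : set (plane R) := [set p | `|p| <= r].

(* near_weight l dominates 1 / |p| + 2 ^ l on the box of radius 2 ^ -l, and
   far_weight l dominates max(|p|, 2 ^ -l) ^ -2. Being sums of indicators of
   dyadic boxes, their integrals are geometric sums. *)
Definition near_weight (R : realType) (l : nat) (p : plane R) : \bar R :=
  (\sum_(0 <= k <oo) (2 ^+ (k + l).+2 * \1_(box (half_pow R (k + l))) p)%:E)%E.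

Definition far_weight (R : realType) (l : nat) (p : plane R) : R :=
  1 + \sum_(k < l) 4 ^+ k.+1 * \1_(box (half_pow R k)) p.

Lemma half_pow_gt0 (R : realType) l : 0 < half_pow R l.
Proof. by rewrite exprn_gt0// invr_gt0. Qed.

Lemma half_powV (R : realType) l : (half_pow R l)^-1 = 2 ^+ l.
Proof. by rewrite /half_pow exprVn invrK. Qed.

Lemma half_powS (R : realType) l : half_pow R l.+1 = half_pow R l / 2.
Proof. by rewrite /half_pow exprSr. Qed.

Lemma half_pow_small (R : realType) (e : R) : 0 < e -> exists n, half_pow R n <= e.
Proof. by move=> e0; apply: expr_small; rewrite ?invr_ge0// invf_lt1// ltr1n. Qed.

Lemma indic_box (R : realType) (r : R) (p : plane R) :
  \1_(box r) p = (`|p| <= r)%R%:R :> R.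
Proof.
rewrite indicE; congr (_%:R).
congr (nat_of_bool _); apply/idP/idP => [/set_mem|h]; [by []|exact: mem_set].
Qed.

(** One step of a telescoping sum: lowering the truncation level affects the truncated inverse only
    for [r <= 2 ^ -m], and there the new value is at most [2 ^ m.+1]. *)
Lemma max_half_pow_inv_le (R : realType) (r : R) m : 0 <= r ->
  (Num.max r (half_pow R m.+1))^-1 <=
    (Num.max r (half_pow R m))^-1 + 2 ^+ m.+1 * (r <= half_pow R m)%R%:R.
Proof.
move=> r0; have h0 := half_pow_gt0 R m; have h1 := half_pow_gt0 R m.+1.
have hh : half_pow R m.+1 <= half_pow R m by rewrite half_powS; lra.
case: (leP r (half_pow R m)) => hr; rewrite ?mulr1n ?mulr0n ?mulr1 ?mulr0 ?addr0.
  rewrite -(half_powV R m.+1) -[leLHS]add0r lerD// ?invr_ge0 ?(le_trans r0) ?le_max ?lexx//.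
  by rewrite lef_pV2 ?posrE ?lt_max ?h1 ?orbT ?le_max ?lexx ?orbT.
by rewrite max_l// ltW// (le_lt_trans hh).
Qed.

Lemma near_weight_ge0 (R : realType) l (p : plane R) : (0 <= near_weight l p)%E.
Proof.
by apply: nneseries_ge0 => k _ _; rewrite lee_fin mulr_ge0// exprn_ge0.
Qed.

Lemma near_weight_ge (R : realType) l (p : plane R) : `|p| <= half_pow R l ->
  ((`|p|^-1 + 2 ^+ l)%:E <= near_weight l p)%E.
Proof.
move=> pl.
(* The first [n] terms dominate the inverse truncated at [2 ^ -(n + l)]. The truncation is removed
   at the end by taking [2 ^ -n <= |p|]; at the origin the inverse is 0 and one term suffices. *)
have partial n : (n > 0)%N ->
    (((Num.max `|p| (half_pow R (n + l)))^-1 + 2 ^+ l)%:E <= near_weight l p)%E.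
  move=> n0; apply: (@le_trans _ _ (\sum_(0 <= k < n)
      (2 ^+ (k + l).+2 * \1_(box (half_pow R (k + l))) p)%:E)%E); last first.
    by apply: nneseries_lim_ge => k _; rewrite lee_fin mulr_ge0// exprn_ge0.
  rewrite sumEFin lee_fin.
  elim: n n0 => // n IH _; case: n IH => [_|n IH].
    (* The exponent [.+2] of the weight is used up here: [2 ^ l + 2 ^ l.+1 + 2 ^ l = 2 ^ l.+2]. *)
    rewrite big_nat1 add0n add1n indic_box pl mulr1.
    apply: (le_trans (lerD (max_half_pow_inv_le _ (normr_ge0 p)) (lexx _))).
    rewrite pl mulr1 max_r// half_powV !exprS.
    have := exprn_gt0 l (ltr0n R 2); lra.
  rewrite big_nat_recr//=.
  apply: (le_trans (lerD (max_half_pow_inv_le _ (normr_ge0 p)) (lexx _))).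
  rewrite addrAC; apply: lerD; first exact: IH.
  by rewrite indic_box ler_wpM2r// ler_eXn2l// ltr1n.
have [p0|p0] := eqVneq `|p| 0.
  apply: le_trans (partial 1%N _) => //.
  by rewrite lee_fin p0 invr0 lerD2r invr_ge0 le_max lexx.
have p_gt0 : 0 < `|p| by rewrite lt0r p0 normr_ge0.
have [n hn] := half_pow_small p_gt0.
apply: le_trans (partial n.+1 _) => //.
rewrite lee_fin lerD2r max_l//; apply: le_trans hn.
rewrite /half_pow; apply: ler_wiXn2l; rewrite ?invr_ge0 ?invf_le1 ?ler1n//.
by rewrite addSn leqW// leq_addr.
Qed.

(** On the box of radius [2 ^ -l] the new term [4 ^ l.+1] suffices alone; outside it the truncation
    is inactive and the left side is the same for [l] and [l.+1]. *)
Lemma far_weight_ge (R : realType) l (p : plane R) :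
  (Num.max `|p| (half_pow R l))^-1 ^+ 2 <= far_weight l p.
Proof.
elim: l => [|l IH].
  rewrite /far_weight big_ord0 addr0 -[leRHS](expr1n _ 2) lerXn2r// ?nnegrE ?invr_ge0//.
  - by rewrite le_max normr_ge0.
  - by rewrite invf_le1 ?le_max ?lt_max /half_pow ?expr0 ?lexx ?orbT// ltr01 orbT.
rewrite /far_weight big_ord_recr/= addrA indic_box.
case: (leP `|p| (half_pow R l)) => pl; last first.
  rewrite mulr0 addr0; apply: le_trans IH.
  rewrite max_l ?(max_l (ltW pl))//.
  rewrite half_powS; have := half_pow_gt0 R l; lra.
rewrite mulr1 -[leLHS]add0r lerD//.
  by rewrite addr_ge0// sumr_ge0// => k _; rewrite mulr_ge0// exprn_ge0.
have -> : 4 ^+ l.+1 = (half_pow R l.+1)^-1 ^+ 2.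
  rewrite half_powV -exprM mulnC exprM; congr (_ ^+ _); ring.
rewrite lerXn2r// ?nnegrE ?invr_ge0 ?le_max ?normr_ge0 ?(ltW (half_pow_gt0 _ _))//.
by rewrite lef_pV2 ?posrE ?lt_max ?half_pow_gt0 ?orbT// le_max lexx orbT.
Qed.

Definition coord (R : realType) (i : bool) (p : plane R) : R :=
  if i then p.1 else p.2.

Lemma coordB (R : realType) i (p q : plane R) :
  coord i (p - q) = coord i p - coord i q.
Proof. by case: i. Qed.

Lemma coord_le_norm (R : realType) i (p : plane R) : `|coord i p| <= `|p|.
Proof. by case: i; rewrite (plane_norm_fst, plane_norm_snd). Qed.

Lemma norm_le_coord (R : realType) (p : plane R) (r : R) :
  (forall i, `|coord i p| <= r) -> `|p| <= r.
Proof. by move=> h; rewrite plane_norm_le (h true) (h false). Qed.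

Definition kernel (R : realType) (i : bool) (p : plane R) : R :=
  coord i (biot_savart_kernel p).

Lemma kernel_le_inv (R : realType) i (p : plane R) : `|kernel i p| <= `|p|^-1.
Proof. by case: i; have [] := kernel_le p. Qed.

(* A logarithmic modulus of continuity in disguise: after integration the right
   hand side is O(2 ^ -l + d l) for every l, and l ~ log(1 / d) is optimal. *)
Lemma kernel_near_far (R : realType) i l (p q : plane R) (d : R) :
  `|p - q| <= d ->
  (`|kernel i p - kernel i q|%:E <= near_weight l p + near_weight l q +
     (d * (far_weight l p + far_weight l q))%:E)%E.
Proof.
move=> pq; have d0 : 0 <= d by apply: le_trans pq.
have h0 := half_pow_gt0 R l.
have fp := far_weight_ge l p; have fq := far_weight_ge l q.
have fp0 : 0 <= far_weight l p by apply: le_trans fp; rewrite sqr_ge0.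
have fq0 : 0 <= far_weight l q by apply: le_trans fq; rewrite sqr_ge0.
have far0 : (0 <= (d * (far_weight l p + far_weight l q))%:E)%E.
  by rewrite lee_fin mulr_ge0// addr_ge0.
have np := near_weight_ge0 l p; have nq := near_weight_ge0 l q.
have tri : `|kernel i p - kernel i q| <= `|p|^-1 + `|q|^-1.
  by rewrite (le_trans (ler_normB _ _))// lerD// kernel_le_inv.
have inv2 (s : plane R) : half_pow R l < `|s| -> `|s|^-1 <= 2 ^+ l.
  by move=> sl; rewrite -half_powV lef_pV2 ?posrE// ?ltW// (lt_trans h0).
(* If at least one point lies in the box, the triangle inequality suffices, and the summand [2 ^ l]
   of [near_weight_ge] pays for a point outside. If both lie outside,
   [1 / (|p| * |q|) <= |p| ^ -2 + |q| ^ -2]. *)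
have [pl|pl] := leP `|p| (half_pow R l); have [ql|ql] := leP `|q| (half_pow R l).
- apply: le_trans (leeDl _ far0).
  apply: le_trans (leeD (near_weight_ge pl) (near_weight_ge ql)).
  rewrite -EFinD lee_fin (le_trans tri)// lerD// lerDl exprn_ge0//.
- apply: le_trans (leeDl _ far0); apply: le_trans (leeDl _ nq).
  apply: le_trans (near_weight_ge pl).
  by rewrite lee_fin (le_trans tri)// lerD// inv2.
- apply: le_trans (leeDl _ far0); apply: le_trans (leeDr _ np).
  apply: le_trans (near_weight_ge ql).
  by rewrite lee_fin (le_trans tri)// addrC lerD// inv2.
- apply: le_trans (leeDr _ (adde_ge0 np nq)).
  have p0 : 0 < `|p| := lt_trans h0 pl.
  have q0 : 0 < `|q| := lt_trans h0 ql.
  rewrite max_l ?(ltW pl)// in fp; rewrite max_l ?(ltW ql)// in fq.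
  have [] := @kernel_diff _ p q; rewrite -?normr_gt0// => k1 k2.
  apply: (@le_trans _ _ (`|p - q| / (`|p| * `|q|))%:E).
    by rewrite lee_fin; case: i {tri}.
  rewrite lee_fin ler_pM ?invr_ge0 ?mulr_ge0//.
  apply: le_trans (lerD fp fq); rewrite invfM.
  have := sqr_ge0 (`|p|^-1 - `|q|^-1).
  have := sqr_ge0 (`|p|^-1); have := sqr_ge0 (`|q|^-1); nra.
Qed.

Lemma measurable_plane_norm (R : realType) :
  measurable_fun setT (fun p : plane R => `|p|).
Proof.
under eq_fun do rewrite plane_normE.
by apply: measurable_maxr; apply: measurableT_comp.
Qed.

Lemma measurable_coord (R : realType) i : measurable_fun setT (@coord R i).
Proof. by case: i; [exact: measurable_fst|exact: measurable_snd]. Qed.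

Lemma measurable_kernel (R : realType) i : measurable_fun setT (@kernel R i).
Proof.
have mV : measurable_fun setT (fun p : plane R => (2 * pi * (p.1 ^+ 2 + p.2 ^+ 2))^-1).
  (* The inverse is read as the power [-1], whose measurability is known; both are 0 at the
     origin. *)
  rewrite (_ : (fun _ => _) = (@powR R ^~ (-1)) \o
      (fun p : plane R => 2 * pi * (p.1 ^+ 2 + p.2 ^+ 2))); last first.
    apply/funext => p /=; rewrite powR_inv1// mulr_ge0 ?mulr_ge0 ?pi_ge0//.
    by rewrite addr_ge0 ?sqr_ge0.
  apply: measurableT_comp; first exact: measurable_powR.
  apply: measurable_funM => //; apply: measurable_funD; exact: measurable_funX.
case: i; rewrite /kernel /coord /biot_savart_kernel /=.
- by apply: measurable_funM => //; exact: measurableT_comp.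
- exact: measurable_funM.
Qed.

Lemma measurable_box (R : realType) (r : R) : measurable (box r).
Proof.
rewrite (_ : box r = (fun p : plane R => `|p|) @^-1` [set` `]-oo, r]%R]).
  by rewrite -[X in measurable X]setTI; apply: measurable_plane_norm.
by apply/seteqP; split => p /=; rewrite in_itv.
Qed.

Lemma plane_box_measure (R : realType) (z : plane R) (r : R) : 0 <= r ->
  leb2 R [set p | `|z - p| <= r] = (4 * r ^+ 2)%:E.
Proof.
move=> r0.
have -> : [set p | `|z - p| <= r] =
    `[z.1 - r, z.1 + r]%classic `*` `[z.2 - r, z.2 + r]%classic.
  by apply/seteqP; split => p /=; rewrite plane_norm_le /= !ler_distlC !in_itv /=
    => /andP.
have side (a : R) : lebesgue_measure (`[a - r, a + r]%classic : set R) = (2 * r)%:E.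
  rewrite lebesgue_measure_itv /= lte_fin.
  have [->|rn0] := eqVneq r 0; first by rewrite subr0 addr0 ltxx mulr0.
  have r_gt0 : 0 < r by rewrite lt0r rn0.
  by rewrite ifT ?ltrD2l ?gtrN// -EFinB; congr _%:E; ring.
rewrite product_measure1E// [X in (X * _)%E]side [X in (_ * X)%E]side -EFinM.
by congr _%:E; ring.
Qed.

(* The only trace of measure preservation that the kernel estimates need. *)
Definition spread d (T : measurableType d) (R : realType)
    (mu : {measure set T -> \bar R}) (G : T -> plane R) : Prop :=
  measurable_fun setT G /\
  forall r : R, 0 <= r -> (mu [set y | (`|G y| <= r)%R] <= (4 * r ^+ 2)%:E)%E.

Lemma measurable_near_weight (R : realType) l :
  measurable_fun setT (@near_weight R l).
Proof.
apply: ge0_emeasurable_sum => [k p _ _|k _].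
  by rewrite lee_fin mulr_ge0// exprn_ge0.
apply/measurable_EFinP; apply: measurable_funM => //.
by apply: measurable_indic; exact: measurable_box.
Qed.

Lemma measurable_far_weight (R : realType) l : measurable_fun setT (@far_weight R l).
Proof.
apply: measurable_funD => //; apply: measurable_sum => k.
apply: measurable_funM => //.
by apply: measurable_indic; exact: measurable_box.
Qed.

Lemma far_weight_ge0 (R : realType) l (p : plane R) : 0 <= far_weight l p.
Proof.
by rewrite addr_ge0// sumr_ge0// => k _; rewrite mulr_ge0// exprn_ge0.
Qed.

Lemma spread_box d (T : measurableType d) (R : realType)
    (mu : {measure set T -> \bar R}) (G : T -> plane R) (r : R) :
  spread mu G -> 0 <= r ->
  (\int[mu]_y (\1_(box r) (G y))%:E <= (4 * r ^+ 2)%:E)%E.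
Proof.
move=> [mG hG] r0.
under eq_integral => y _.
  rewrite (_ : \1_(box r) (G y) = \1_(G @^-1` box r) y); last by rewrite !indicE.
  over.
rewrite integral_indic// ?setIT; last first.
  by rewrite -[X in measurable X]setTI; apply: mG => //; exact: measurable_box.
exact: hG.
Qed.

(** A box of radius [2 ^ -j] has a preimage of measure at most [4 * 4 ^ -j], so its term contributes
    at most [16 * A * 2 ^ -j]; the sum over [j >= l] is [32 * A * 2 ^ -l]. *)
Lemma spread_near_weight d (T : measurableType d) (R : realType)
    (mu : {measure set T -> \bar R}) (G : T -> plane R) (w : T -> R) (A : R) l :
  spread mu G -> measurable_fun setT w -> (forall y, `|w y| <= A) -> 0 <= A ->
  (\int[mu]_y (`|w y|%:E * near_weight l (G y)) <= (32 * A * half_pow R l)%:E)%E.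
Proof.
move=> hG mw wA A0; have mG := hG.1.
have mn : measurable_fun setT (near_weight l \o G).
  by apply: measurableT_comp => //; exact: measurable_near_weight.
apply: (@le_trans _ _ (\int[mu]_y (A%:E * near_weight l (G y)))%E).
  apply: ge0_le_integral => //.
  - by move=> y _; rewrite mule_ge0// near_weight_ge0.
  - apply: emeasurable_funM => //; apply/measurable_EFinP.
    exact: measurableT_comp.
  - exact: measurable_funeM.
  - by move=> y _; rewrite lee_wpmul2r ?near_weight_ge0// lee_fin.
rewrite ge0_integralZl_EFin//; last by move=> y _; rewrite near_weight_ge0.
rewrite mulrAC EFinM [leRHS]muleC; apply: lee_wpmul2l; first by rewrite lee_fin.
rewrite integral_nneseries//; last first.
  move=> k; apply/measurable_EFinP; apply: measurable_funM => //.
  apply: measurableT_comp => //.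
  by apply: measurable_indic; exact: measurable_box.
have geo := @cvg_geometric_eseries_half R (32 * half_pow R l) 0.
rewrite expr0 divr1 in geo.
rewrite -(cvg_lim _ geo)//.
apply: lee_nneseries => k _.
  by move=> _; apply: integral_ge0 => y _; rewrite lee_fin mulr_ge0// exprn_ge0.
under eq_integral do rewrite EFinM.
rewrite ge0_integralZl_EFin ?exprn_ge0//; last first.
  apply/measurable_EFinP; apply: measurableT_comp => //.
  by apply: measurable_indic; exact: measurable_box.
apply: (@le_trans _ _ ((2 ^+ (k + l).+2)%:E * (4 * half_pow R (k + l) ^+ 2)%:E)%E).
  rewrite lee_wpmul2l ?lee_fin ?exprn_ge0//.
  by apply: spread_box => //; rewrite ltW// half_pow_gt0.
rewrite -EFinM lee_fin addn1 natrX.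
rewrite (_ : half_pow R (k + l) = half_pow R k * half_pow R l); last by rewrite /half_pow exprD.
rewrite -!(half_powV R) /half_pow.
rewrite !exprS exprD.
set a := 2^-1 ^+ k; set b := 2^-1 ^+ l.
have a0 : a != 0 by rewrite expf_neq0// invr_eq0.
have b0 : b != 0 by rewrite expf_neq0// invr_eq0.
rewrite le_eqVlt; apply/orP; left; apply/eqP; field.
by rewrite a0 b0.
Qed.

(** Each of the [l] boxes contributes the same amount, [A * 4 ^ k.+1 * (4 * 4 ^ -k) = 16 * A]. This
    is where the logarithm comes from. *)
Lemma spread_far_weight d (T : measurableType d) (R : realType)
    (mu : {measure set T -> \bar R}) (G : T -> plane R) (w : T -> R) (A M : R) l :
  spread mu G -> measurable_fun setT w -> (forall y, `|w y| <= A) -> 0 <= A ->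
  (\int[mu]_y `|w y|%:E <= M%:E)%E ->
  (\int[mu]_y (`|w y| * far_weight l (G y))%:E <= (M + 16 * A * l%:R)%:E)%E.
Proof.
move=> hG mw wA A0 wM; have mG := hG.1.
have mnw : measurable_fun setT (fun y => `|w y|) by exact: measurableT_comp.
elim: l => [|l IH].
  under eq_integral do rewrite /far_weight big_ord0 addr0 mulr1.
  by rewrite mulr0 addr0.
under eq_integral do rewrite /far_weight big_ord_recr/= addrA mulrDr EFinD.
have mf k : measurable_fun setT (fun y => `|w y| * (4 ^+ k.+1 * \1_(box (half_pow R k)) (G y))).
  apply: measurable_funM => //; apply: measurable_funM => //.
  apply: measurableT_comp => //; apply: measurable_indic; exact: measurable_box.
have mF : measurable_fun setT (fun y => `|w y| * far_weight l (G y)).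
  apply: measurable_funM => //; apply: measurableT_comp => //.
  exact: measurable_far_weight.
rewrite ge0_integralD//; first last.
- exact/measurable_EFinP.
- exact/measurable_EFinP.
- by move=> y _; rewrite lee_fin mulr_ge0// far_weight_ge0.
rewrite (_ : (M + _)%:E = (M + 16 * A * l%:R)%:E + (16 * A)%:E)%E; last first.
  by rewrite -EFinD -natr1; congr _%:E; ring.
apply: leeD; first exact: IH.
have m1 : measurable_fun setT (fun y => \1_(box (half_pow R l)) (G y) : R).
  by apply: measurableT_comp => //; apply: measurable_indic; exact: measurable_box.
apply: (@le_trans _ _ (\int[mu]_y ((A * 4 ^+ l.+1)%:E * (\1_(box (half_pow R l)) (G y))%:E))%E).
  apply: ge0_le_integral => //.
  - exact/measurable_EFinP.
  - by apply: measurable_funeM; apply/measurable_EFinP.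
  - by move=> y _; rewrite -EFinM lee_fin -mulrA ler_wpM2r// ?mulr_ge0// ?exprn_ge0.
rewrite ge0_integralZl_EFin ?mulr_ge0 ?exprn_ge0//; last exact/measurable_EFinP.
apply: (@le_trans _ _ ((A * 4 ^+ l.+1)%:E * (4 * half_pow R l ^+ 2)%:E)%E).
  rewrite lee_wpmul2l ?lee_fin ?mulr_ge0 ?exprn_ge0//.
  by apply: spread_box => //; rewrite ltW// half_pow_gt0.
rewrite -EFinM lee_fin.
have -> : half_pow R l ^+ 2 = (4 ^+ l)^-1.
  rewrite /half_pow -exprM mulnC exprM -exprVn; congr (_ ^+ _).
  by rewrite exprVn; congr _^-1; ring.
rewrite exprS -!mulrA [X in A * (4 * X)]mulrCA mulfV ?mulr1.
  lra.
by rewrite expf_neq0.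
Qed.

(** * Integral estimates for the kernel *)

(** The bound [A] holds at every point, so that the kernel estimates can be pointwise; the data are
    brought into this class by [clip]. *)
Definition density d (T : measurableType d) (R : realType)
    (mu : {measure set T -> \bar R}) (A M : R) (w : T -> R) : Prop :=
  [/\ measurable_fun setT w, forall y, `|w y| <= A &
      (\int[mu]_y `|w y|%:E <= M%:E)%E].

Lemma kernel_bound (R : realType) i (p : plane R) :
  (`|kernel i p|%:E <= near_weight 0 p + 1)%E.
Proof.
have k := kernel_le_inv i p; have [p1|p1] := leP `|p| 1.
  apply: le_trans (leeDl _ lee01); apply: le_trans (near_weight_ge _) => //.
  by rewrite lee_fin (le_trans k)// lerDl expr0.
apply: le_trans (leeDr _ (near_weight_ge0 _ _)).
by rewrite lee_fin (le_trans k)// invf_le1 ?(ltW p1)// (lt_trans _ p1).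
Qed.

Lemma measurable_kernelM d (T : measurableType d) (R : realType) i
    (G : T -> plane R) (w : T -> R) : measurable_fun setT G -> measurable_fun setT w ->
  measurable_fun setT (fun y => kernel i (G y) * w y).
Proof.
move=> mG mw; apply: measurable_funM => //.
by apply: measurableT_comp => //; exact: measurable_kernel.
Qed.

Lemma kernel_integral_bound d (T : measurableType d) (R : realType)
    (mu : {measure set T -> \bar R}) (A M : R) (w : T -> R) i (G : T -> plane R) :
  0 <= A -> density mu A M w -> spread mu G ->
  (\int[mu]_y `|kernel i (G y) * w y|%:E <= (32 * A + M)%:E)%E.
Proof.
move=> A0 [mw wA wM] hG; have mG := hG.1.
have mn : measurable_fun setT (fun y => `|w y|%:E * near_weight 0 (G y))%E.
  apply: emeasurable_funM; first by apply/measurable_EFinP; exact: measurableT_comp.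
  by apply: measurableT_comp => //; exact: measurable_near_weight.
have mnw : measurable_fun setT (fun y => `|w y|%:E).
  by apply/measurable_EFinP; exact: measurableT_comp.
apply: (@le_trans _ _ (\int[mu]_y (`|w y|%:E * near_weight 0 (G y) + `|w y|%:E))%E).
  apply: ge0_le_integral => //.
  - apply/measurable_EFinP; apply: measurableT_comp => //; exact: measurable_kernelM.
  - exact: emeasurable_funD.
  - move=> y _; rewrite normrM EFinM muleC.
    apply: (le_trans (lee_wpmul2l _ (kernel_bound i (G y)))) => //.
    by rewrite muleDr ?mule1// ge0_adde_def ?inE// near_weight_ge0.
rewrite ge0_integralD//; last first.
  by move=> y _; rewrite mule_ge0// near_weight_ge0.
rewrite EFinD; apply: leeD => //.
by have := spread_near_weight 0 hG mw wA A0; rewrite /half_pow expr0 mulr1.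
Qed.

(** Both [G y] and [H y] contribute, which doubles the constants of the two weights. The restriction
    to [D] serves the comparison of two flows, whose distance is bounded uniformly only on boxes. *)
Lemma kernel_log_lipschitz d (T : measurableType d) (R : realType)
    (mu : {measure set T -> \bar R}) (A M : R) (w : T -> R) i l (D : set T)
    (G H : T -> plane R) (e : R) :
  0 <= A -> 0 <= e -> density mu A M w -> spread mu G -> spread mu H ->
  measurable D -> (forall y, D y -> `|G y - H y| <= e) ->
  (\int[mu]_(y in D) `|(kernel i (G y) - kernel i (H y)) * w y|%:E <=
    (64 * A * half_pow R l + 2 * e * (M + 16 * A * l%:R))%:E)%E.
Proof.
move=> A0 e0 [mw wA wM] hG hH mD GH; have mG := hG.1; have mH := hH.1.
have mnw : measurable_fun setT (fun y => `|w y|%:E).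
  by apply/measurable_EFinP; exact: measurableT_comp.
have mn F : measurable_fun setT F ->
    measurable_fun setT (fun y => `|w y|%:E * near_weight l (F y))%E.
  move=> mF; apply: emeasurable_funM => //.
  by apply: measurableT_comp => //; exact: measurable_near_weight.
have mf F : measurable_fun setT F ->
    measurable_fun setT (fun y => (e * (`|w y| * far_weight l (F y)))%:E).
  move=> mF; apply/measurable_EFinP; apply: measurable_funM => //.
  apply: measurable_funM; first exact/measurable_EFinP.
  by apply: measurableT_comp => //; exact: measurable_far_weight.
have n0 F (y : T) : (0 <= `|w y|%:E * near_weight l (F y))%E.
  by rewrite mule_ge0// near_weight_ge0.
have f0 F (y : T) : (0 <= (e * (`|w y| * far_weight l (F y)))%:E)%E.
  by rewrite lee_fin !mulr_ge0// far_weight_ge0.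
have int_f F : spread mu F ->
    (\int[mu]_y (e * (`|w y| * far_weight l (F y)))%:E <= (e * (M + 16 * A * l%:R))%:E)%E.
  move=> hF; under eq_integral do rewrite EFinM.
  rewrite ge0_integralZl_EFin//.
  - by rewrite EFinM lee_wpmul2l ?lee_fin//; exact: spread_far_weight.
  - by move=> y _; rewrite lee_fin mulr_ge0// far_weight_ge0.
  - apply/measurable_EFinP; apply: measurable_funM; first exact/measurable_EFinP.
    by apply: measurableT_comp; [exact: measurable_far_weight|exact: hF.1].
pose B := (fun y => `|w y|%:E * near_weight l (G y) + `|w y|%:E * near_weight l (H y)
  + ((e * (`|w y| * far_weight l (G y)))%:E + (e * (`|w y| * far_weight l (H y)))%:E))%E.
have mB : measurable_fun setT B.
  by apply: emeasurable_funD; apply: emeasurable_funD; solve [exact: mn|exact: mf].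
have B0 y : (0 <= B y)%E by rewrite !adde_ge0.
apply: (@le_trans _ _ (\int[mu]_(y in D) B y)%E).
  apply: ge0_le_integral => //.
  - apply/measurable_EFinP/measurable_funTS; apply: measurableT_comp => //.
    apply: measurable_funM => //; apply: measurable_funB;
    by apply: measurableT_comp => //; exact: measurable_kernel.
  - exact: measurable_funTS.
  - move=> y Dy; rewrite normrM EFinM muleC.
    apply: (le_trans (lee_wpmul2l _ (kernel_near_far i l (GH y Dy)))) => //.
    rewrite /B muleDr// ?muleDr//; last 2 first.
    + by rewrite ge0_adde_def ?inE// near_weight_ge0.
    + rewrite ge0_adde_def ?inE// ?adde_ge0 ?near_weight_ge0//.
      by rewrite lee_fin mulr_ge0// addr_ge0// far_weight_ge0.
    by rewrite leeD2l// -EFinM -EFinD lee_fin le_eqVlt; apply/orP; left; apply/eqP; ring.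
apply: (@le_trans _ _ (\int[mu]_y B y)%E).
  by apply: ge0_subset_integral.
rewrite /B ge0_integralD//; last 4 first.
- by move=> y _; rewrite adde_ge0.
- by apply: emeasurable_funD; exact: mn.
- by move=> y _; rewrite adde_ge0.
- by apply: emeasurable_funD; exact: mf.
rewrite ge0_integralD//; last 2 first.
- exact: mn.
- exact: mn.
rewrite ge0_integralD//; last 2 first.
- exact: mf.
- exact: mf.
rewrite (_ : (_ + _)%:E = ((32 * A * half_pow R l)%:E + (32 * A * half_pow R l)%:E) +
  ((e * (M + 16 * A * l%:R))%:E + (e * (M + 16 * A * l%:R))%:E))%E; last first.
  by rewrite -!EFinD; congr _%:E; ring.
by rewrite !leeD//; solve [exact: spread_near_weight|exact: int_f].
Qed.

Lemma kernel_tail d (T : measurableType d) (R : realType)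
    (mu : {measure set T -> \bar R}) (A M : R) (w : T -> R) i (D : set T)
    (G : T -> plane R) (r : R) :
  density mu A M w -> measurable_fun setT G -> measurable D -> 0 < r ->
  (forall y, D y -> r <= `|G y|) ->
  (\int[mu]_(y in D) `|kernel i (G y) * w y|%:E <= (M / r)%:E)%E.
Proof.
move=> [mw wA wM] mG mD r0 Gr.
have mnw : measurable_fun setT (fun y => `|w y|%:E).
  by apply/measurable_EFinP; exact: measurableT_comp.
apply: (@le_trans _ _ (\int[mu]_(y in D) ((r^-1)%:E * `|w y|%:E))%E).
  apply: ge0_le_integral => //.
  - apply/measurable_EFinP/measurable_funTS; apply: measurableT_comp => //.
    exact: measurable_kernelM.
  - by apply: measurable_funeM; exact: measurable_funTS.
  - move=> y Dy; rewrite -EFinM lee_fin normrM ler_wpM2r//.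
    rewrite (le_trans (kernel_le_inv _ _))// lef_pV2 ?posrE ?Gr//.
    exact: lt_le_trans r0 (Gr _ Dy).
rewrite ge0_integralZl_EFin ?invr_ge0 ?(ltW r0)//; last exact: measurable_funTS.
rewrite mulrC EFinM lee_wpmul2l ?lee_fin ?invr_ge0 ?(ltW r0)//.
by apply: le_trans wM; apply: ge0_subset_integral.
Qed.

(** * Velocities and flows *)

Lemma is_derive_continuous (R : realType) (f df : R -> R) (a b : R) :
  (forall x : R, is_derive x (1 : R) f (df x)) -> {within `[a, b], continuous f}.
Proof.
move=> hf; apply: continuous_subspaceT => x.
by apply: differentiable_continuous; apply/derivable1_diffP; apply: ex_derive.
Qed.

(** The mean value theorem for [g + f] and [g - f]. Comparing derivatives, rather than integrating
    in time, avoids any discussion of the measurability of the velocity in time. *)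
Lemma derive_comparison (R : realType) (f df g dg : R -> R) (a b : R) : a <= b ->
  (forall x : R, is_derive x (1 : R) f (df x)) ->
  (forall x : R, is_derive x (1 : R) g (dg x)) ->
  (forall x : R, a <= x <= b -> `|df x| <= dg x) ->
  `|f a| <= g a -> `|f b| <= g b.
Proof.
move=> ab hf hg hd fa.
have main (h dh : R -> R) : (forall x : R, is_derive x (1 : R) h (dh x)) ->
    (forall x : R, a <= x <= b -> 0 <= dh x) -> 0 <= h a -> 0 <= h b.
  move=> hh h0 ha.
  have [c cab e] := MVT_segment ab (fun x _ => hh x) (is_derive_continuous hh).
  rewrite -(subrK (h a) (h b)) e addr_ge0// mulr_ge0 ?subr_ge0//.
  by apply: h0; move: cab; rewrite in_itv.
rewrite ler_norml; apply/andP; split.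
- rewrite -subr_ge0 opprK; apply: (main (fun x => f x + g x) (fun x => df x + dg x)).
  + by move=> x /hd; rewrite ler_norml => /andP[+ _]; lra.
  + by move: fa; rewrite ler_norml => /andP[+ _]; lra.
- rewrite -subr_ge0; apply: (main (fun x => g x - f x) (fun x => dg x - df x)).
  + by move=> x /hd; rewrite ler_norml => /andP[_]; lra.
  + by move: fa; rewrite ler_norml => /andP[_]; lra.
Qed.

(** Map and density are separate arguments because the source term pairs the limit flow with the
    difference of two data. *)
Definition velocity (R : realType) (i : bool) (F : plane R -> plane R)
    (w : plane R -> R) (z : plane R) : R :=
  \int[leb2 R]_y (kernel i (z - F y) * w y).

(* The Euler equations along trajectories, forward (sg = 1) or backward (sg = -1)
   in time; w is the initial vorticity. *)
Definition lagrangian_flow (R : realType) (sg : R) (w : plane R -> R)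
    (F : R -> plane R -> plane R) : Prop :=
  [/\ forall s, measure_preserving (leb2 R) (F s),
      forall x, F 0 x = x &
      forall i s x, is_derive s (1 : R) (fun s => coord i (F s x))
                      (sg * velocity i (F s) w (F s x))].

Lemma measurable_plane (d : measure_display) (T : measurableType d) (R : realType)
    (G : T -> plane R) :
  (forall i, measurable_fun setT (fun y => coord i (G y))) -> measurable_fun setT G.
Proof.
move=> h; rewrite (_ : G = fun y => ((G y).1, (G y).2)); last first.
  by apply/funext => y; case: (G y).
by apply: measurable_fun_pair; [exact: (h true)|exact: (h false)].
Qed.

Lemma measurable_sub_fun (d : measure_display) (T : measurableType d) (R : realType)
    (z : plane R) (G : T -> plane R) :
  measurable_fun setT G -> measurable_fun setT (fun y => z - G y).
Proof.
move=> mG; apply: measurable_plane => i; under eq_fun do rewrite coordB.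
by apply: measurable_funB => //; apply: measurableT_comp => //; exact: measurable_coord.
Qed.

Lemma measure_preserving_spread (R : realType) (F : plane R -> plane R) z :
  measure_preserving (leb2 R) F -> spread (leb2 R) (fun y => z - F y).
Proof.
move=> [mF hF]; split; first exact: measurable_sub_fun.
move=> r r0; rewrite -(plane_box_measure z r0).
rewrite -(hF [set p | `|z - p| <= r])//.
rewrite -[X in measurable X]setTI.
rewrite (_ : [set p | _] = (fun p : plane R => z - p) @^-1` box r)//.
have : measurable_fun setT (fun p : plane R => z - p).
  by apply: (@measurable_sub_fun _ _ _ z id).
by apply => //; exact: measurable_box.
Qed.

Lemma integrable_kernel (R : realType) (A M : R) (w : plane R -> R) i
    (F : plane R -> plane R) z :
  0 <= A -> density (leb2 R) A M w -> measure_preserving (leb2 R) F ->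
  (leb2 R).-integrable setT (fun y => (kernel i (z - F y) * w y)%:E).
Proof.
move=> A0 hw hF; have hs := measure_preserving_spread z hF.
apply/integrableP; split.
  by apply/measurable_EFinP; apply: measurable_kernelM; [case: hs|case: hw].
exact: le_lt_trans (kernel_integral_bound i A0 hw hs) (ltry _).
Qed.

Lemma Rintegral_norm_le d (T : measurableType d) (R : realType)
    (mu : {measure set T -> \bar R}) (f : T -> R) (c : R) :
  mu.-integrable setT (EFin \o f) -> (\int[mu]_x `|f x|%:E <= c%:E)%E ->
  `|\int[mu]_x f x| <= c.
Proof.
move=> hf h; apply: (le_trans (le_normr_Rintegral _ hf)) => //.
rewrite /Rintegral -lee_fin fineK//; apply: integrable_fin_num => //.
exact: (integrable_norm hf).
Qed.

Lemma velocity_bound (R : realType) (A M : R) (w : plane R -> R) i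
    (F : plane R -> plane R) z :
  0 <= A -> density (leb2 R) A M w -> measure_preserving (leb2 R) F ->
  `|velocity i F w z| <= 32 * A + M.
Proof.
move=> A0 hw hF; apply: Rintegral_norm_le; first exact: (integrable_kernel _ _ A0 hw hF).
by apply: kernel_integral_bound => //; exact: measure_preserving_spread.
Qed.

Lemma density_ge0 d (T : measurableType d) (R : realType)
    (mu : {measure set T -> \bar R}) (A M : R) (w : T -> R) : density mu A M w -> 0 <= M.
Proof.
by case=> _ _ h; rewrite -lee_fin (le_trans _ h)// integral_ge0.
Qed.

(** Continuity in the point and in the map together, with constants that see the density only
    through [A] and [M]; this is the equicontinuity behind [residual_uniform]. *)
Lemma velocity_log_lipschitz (R : realType) (A M : R) (w : plane R -> R) i l
    (F G : plane R -> plane R) (z z' : plane R) (e : R) :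
  0 <= A -> 0 <= e -> density (leb2 R) A M w -> measure_preserving (leb2 R) F ->
  measure_preserving (leb2 R) G -> (forall y, `|(z - F y) - (z' - G y)| <= e) ->
  `|velocity i F w z - velocity i G w z'| <=
    64 * A * half_pow R l + 2 * e * (M + 16 * A * l%:R).
Proof.
move=> A0 e0 hw hF hG FG; rewrite /velocity -RintegralB//; last 2 first.
- exact: (integrable_kernel _ _ A0 hw hF).
- exact: (integrable_kernel _ _ A0 hw hG).
have E y : kernel i (z - F y) * w y - kernel i (z' - G y) * w y =
  (kernel i (z - F y) - kernel i (z' - G y)) * w y by rewrite mulrBl.
apply: Rintegral_norm_le.
  rewrite (_ : _ \o _ = (fun y => (kernel i (z - F y) * w y)%:E -
     (kernel i (z' - G y) * w y)%:E)%E); last exact/funext.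
  by apply: integrableB => //; apply: (integrable_kernel _ _ A0 hw).
under eq_integral do rewrite E.
by apply: kernel_log_lipschitz => //; exact: measure_preserving_spread.
Qed.

(* Points y with |y| > |x| + L stay at distance L / 2 from the trajectory of x and
   contribute 4 M / L; for the others |P y - Q y| is at most twice the bound at x. *)
Lemma velocity_drift (R : realType) (A M B L D : R) (w : plane R -> R) i l
    (P Q : plane R -> plane R) (x : plane R) :
  0 <= A -> 0 <= B -> 0 < L -> 4 * D <= L -> density (leb2 R) A M w ->
  measure_preserving (leb2 R) P -> measure_preserving (leb2 R) Q ->
  (forall y, `|P y - y| <= D) -> (forall y, `|Q y - y| <= D) ->
  (forall y, `|P y - Q y| <= B * (1 + `|y| / L)) ->
  `|velocity i P w (P x) - velocity i Q w (Q x)| <=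
    64 * A * half_pow R l + 6 * B * (1 + `|x| / L) * (M + 16 * A * l%:R) + 4 * M / L.
Proof.
move=> A0 B0 L0 DL hw hP hQ PD QD PQ; have M0 := density_ge0 hw.
have a0 : 0 <= 1 + `|x| / L by rewrite addr_ge0// divr_ge0// ltW.
rewrite /velocity -RintegralB//; last 2 first.
- exact: (integrable_kernel _ _ A0 hw hP).
- exact: (integrable_kernel _ _ A0 hw hQ).
have E y : kernel i (P x - P y) * w y - kernel i (Q x - Q y) * w y =
  (kernel i (P x - P y) - kernel i (Q x - Q y)) * w y by rewrite mulrBl.
have [mw _ _] := hw.
have hsP := measure_preserving_spread (P x) hP.
have hsQ := measure_preserving_spread (Q x) hQ.
have mP := measurable_kernelM i hsP.1 mw.
have mQ := measurable_kernelM i hsQ.1 mw.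
apply: Rintegral_norm_le.
  rewrite (_ : _ \o _ = (fun y => (kernel i (P x - P y) * w y)%:E -
     (kernel i (Q x - Q y) * w y)%:E)%E); last exact/funext.
  by apply: integrableB => //; apply: (integrable_kernel _ _ A0 hw).
pose near := box (`|x| + L); have mnear : measurable near by exact: measurable_box.
rewrite -(setUv near) ge0_integral_setU//; last 3 first.
- exact: measurableC.
- rewrite setUv; apply/measurable_EFinP; apply: measurableT_comp => //.
  exact: measurable_funB.
- by rewrite disj_set2E setICr.
rewrite EFinD; apply: leeD.
  under eq_integral do rewrite E.
  (* On [near], [|y| / L <= |x| / L + 1], so the distances at [x] and at [y] add up to at most
     [B * (3 + 2 * |x| / L)]; hence the 3. *)
  rewrite (_ : 6 * B * (1 + `|x| / L) = 2 * (3 * B * (1 + `|x| / L))); last by ring.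
  have e0 : 0 <= 3 * B * (1 + `|x| / L) by rewrite !mulr_ge0.
  apply: (kernel_log_lipschitz i l A0 e0 hw hsP hsQ mnear).
  move=> y; rewrite /near /box /= => yx.
  have -> : P x - P y - (Q x - Q y) = (P x - Q x) - (P y - Q y).
    by rewrite [LHS]surjective_pairing [RHS]surjective_pairing /=; congr (_, _); ring.
  apply: (le_trans (ler_normB _ _)); apply: (le_trans (lerD (PQ x) (PQ y))).
  rewrite -mulrDr -mulrA mulrCA ler_wpM2l//.
  have : `|y| / L <= `|x| / L + 1 by rewrite ler_pdivrMr// mulrDl mul1r divfK ?gt_eqF.
  have : 0 <= `|x| / L by rewrite divr_ge0// ltW.
  lra.
(* Here [|y| > |x| + L] and both points move by at most [D <= L / 4], which leaves a distance of at
   least [L - 2 * D >= L / 2]. *)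
have far (S : plane R -> plane R) y : (forall y, `|S y - y| <= D) -> (~` near) y ->
    L / 2 <= `|S x - S y|.
  move=> SD /negP; rewrite /near /box /= -ltNge => yx.
  have h1 := SD x; have h2 := SD y.
  have : `|y| <= `|x| + (`|S x - x| + `|S x - S y| + `|S y - y|).
    have {1}-> : y = x + ((S x - x) - (S x - S y) - (S y - y)).
      by rewrite [LHS]surjective_pairing [RHS]surjective_pairing /=; congr (_, _); ring.
    rewrite (le_trans (ler_normD _ _))// lerD2l.
    by rewrite (le_trans (ler_normB _ _))// lerD2r (le_trans (ler_normB _ _)).
  lra.
have mC : measurable (~` near) by exact: measurableC.
have L2 : 0 < L / 2 by rewrite divr_gt0.
apply: (@le_trans _ _ (\int[leb2 R]_(y in ~` near) (`|kernel i (P x - P y) * w y|%:E +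
    `|kernel i (Q x - Q y) * w y|%:E))%E).
  apply: ge0_le_integral => //.
  - apply/measurable_EFinP/measurable_funTS; apply: measurableT_comp => //.
    exact: measurable_funB.
  - apply: emeasurable_funD; apply/measurable_EFinP/measurable_funTS;
      exact: measurableT_comp.
  - by move=> y _; rewrite -EFinD lee_fin ler_normB.
rewrite ge0_integralD//; last 2 first.
- by apply/measurable_EFinP/measurable_funTS; exact: measurableT_comp.
- by apply/measurable_EFinP/measurable_funTS; exact: measurableT_comp.
rewrite (_ : 4 * M / L = M / (L / 2) + M / (L / 2)); last by field; rewrite gt_eqF.
rewrite EFinD; apply: leeD; apply: (kernel_tail i hw) => //.
- exact: hsP.1.
- by move=> y; exact: far.
- exact: hsQ.1.
- by move=> y; exact: far.
Qed.

Lemma densityB d (T : measurableType d) (R : realType)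
    (mu : {measure set T -> \bar R}) (A M : R) (w v : T -> R) :
  density mu A M w -> density mu A M v -> density mu (2 * A) (2 * M) (fun y => w y - v y).
Proof.
move=> [mw wA wM] [mv vA vM].
have mnw : measurable_fun setT (fun y => `|w y|%:E).
  by apply/measurable_EFinP; exact: measurableT_comp.
have mnv : measurable_fun setT (fun y => `|v y|%:E).
  by apply/measurable_EFinP; exact: measurableT_comp.
split; first exact: measurable_funB.
  by move=> y; rewrite (le_trans (ler_normB _ _))// mulr2n mulrDl mul1r lerD.
apply: (@le_trans _ _ (\int[mu]_y (`|w y|%:E + `|v y|%:E))%E).
  apply: ge0_le_integral => //.
  - by apply/measurable_EFinP; apply: measurableT_comp => //; exact: measurable_funB.
  - exact: emeasurable_funD.
  - by move=> y _; rewrite -EFinD lee_fin ler_normB.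
by rewrite ge0_integralD// mulr2n mulrDl mul1r EFinD leeD.
Qed.

Lemma velocityB (R : realType) (A M : R) (w v : plane R -> R) i
    (F : plane R -> plane R) z : 0 <= A ->
  density (leb2 R) A M w -> density (leb2 R) A M v -> measure_preserving (leb2 R) F ->
  velocity i F (fun y => w y - v y) z = velocity i F w z - velocity i F v z.
Proof.
move=> A0 hw hv hF; rewrite /velocity -RintegralB//.
- by under eq_Rintegral do rewrite mulrBr.
- exact: (integrable_kernel _ _ A0 hw hF).
- exact: (integrable_kernel _ _ A0 hv hF).
Qed.

Lemma flow_speed (R : realType) (A M sg : R) (w : plane R -> R)
    (F : R -> plane R -> plane R) s t x :
  0 <= A -> `|sg| <= 1 -> density (leb2 R) A M w -> lagrangian_flow sg w F ->
  `|F s x - F t x| <= (32 * A + M) * `|s - t|.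
Proof.
move=> A0 sg1 hw [mF F0 dF].
wlog ts : s t / t <= s.
  move=> h; have [|st] := leP t s; first exact: h.
  by rewrite distrC (distrC s); apply: h; exact: ltW.
apply: norm_le_coord => i; rewrite coordB (@ger0_norm _ (s - t)) ?subr_ge0//.
pose V := 32 * A + M.
have hg (r : R) : is_derive r (1 : R) (fun r => V * (r - t)) V.
  have -> : (fun r => V * (r - t)) = (V \*: (@id R - cst t)) by [].
  by apply: is_derive_eq; rewrite subr0 /GRing.scale/= mulr1.
have hf (r : R) : is_derive r (1 : R) (fun r => coord i (F r x) - coord i (F t x))
     (sg * velocity i (F r) w (F r x)).
  have -> : (fun r => coord i (F r x) - coord i (F t x)) =
    ((fun r => coord i (F r x)) - cst (coord i (F t x))) by [].
  have h := dF i r x; apply: is_derive_eq; exact: subr0.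
apply: (derive_comparison ts hf hg); last by rewrite !subrr normr0 mulr0.
move=> r _; rewrite normrM -[leRHS]mul1r ler_pM//.
exact: velocity_bound.
Qed.

Lemma flow_displacement (R : realType) (A M sg T : R) (w : plane R -> R)
    (F : R -> plane R -> plane R) s x :
  0 <= A -> `|sg| <= 1 -> density (leb2 R) A M w -> lagrangian_flow sg w F ->
  0 <= s <= T -> `|F s x - x| <= (32 * A + M) * T.
Proof.
move=> A0 sg1 hw hF /andP[s0 sT]; have [_ F0 _] := hF.
have := flow_speed s 0 x A0 sg1 hw hF; rewrite F0 subr0 => /le_trans; apply.
by rewrite ler_wpM2l ?ger0_norm// addr_ge0 ?mulr_ge0// (density_ge0 hw).
Qed.

(* Vorticity of bounded mass may escape to infinity, so the two flows need not be
   uniformly close: the weight 1 + |x| / L absorbs the distant contributions. *)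
Lemma flow_gronwall (R : realType) (A M sg T L : R) (w v : plane R -> R)
    (F G : R -> plane R -> plane R) (t0 t1 delta theta : R) l :
  0 <= A -> `|sg| <= 1 -> density (leb2 R) A M w -> density (leb2 R) A M v ->
  lagrangian_flow sg w F -> lagrangian_flow sg v G ->
  0 <= t0 -> t1 <= T -> 0 < L -> 4 * ((32 * A + M) * T) <= L ->
  0 <= delta -> 0 <= theta ->
  (forall x, `|F t0 x - G t0 x| <= delta * (1 + `|x| / L)) ->
  (forall i (s : R) (x : plane R), 0 <= s <= T ->
    `|velocity i (G s) (fun y => w y - v y) (G s x)| <= theta * (1 + `|x| / L)) ->
  forall (s : R) (x : plane R), t0 <= s <= t1 ->
    `|F s x - G s x| <=
      2 * (delta + (64 * A * half_pow R l + 4 * M / L + theta) * T) *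
      expR ((12 * (M + 16 * A * l%:R) + 1) * (s - t0)) * (1 + `|x| / L).
Proof.
move=> A0 sg1 hw hv hF hG t0_ge0 t1T L0 VL d0 th0 H0 Hr.
have M0 := density_ge0 hw.
(* The drift [6 * B * (M + 16 * A * l%:R)] is at most [kappa * (B / 2)]: the factor 12 makes its
   integral give back only half of [B]. The summand 1 keeps [kappa] positive. *)
set kappa := 12 * _ + 1; set Phi := 64 * A * _ + _ + _; set E := delta + Phi * T.
have k0 : 0 < kappa.
  by rewrite ltr_wpDl// mulr_ge0// addr_ge0// !mulr_ge0.
have Phi0 : 0 <= Phi.
  by rewrite !addr_ge0 ?mulr_ge0 ?invr_ge0 ?(ltW L0) ?(ltW (half_pow_gt0 _ _)).
have a1 (x : plane R) : 1 <= 1 + `|x| / L by rewrite lerDl divr_ge0// ltW.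
have e1 s : t0 <= s -> 1 <= expR (kappa * (s - t0)).
  by move=> ts; rewrite -expR0 ler_expR mulr_ge0 ?subr_ge0// ltW.
(* The derivative at [x] involves the distance of the flows at every [y], so a bound has to be
   improved for all [x] at once: [B] becomes [E + B / 2], a contraction with fixed point [2 * E]. *)
pose P B := forall s x, t0 <= s <= t1 ->
  `|F s x - G s x| <= B * expR (kappa * (s - t0)) * (1 + `|x| / L).
have disp s x : t0 <= s <= t1 ->
    `|F s x - x| <= (32 * A + M) * T /\ `|G s x - x| <= (32 * A + M) * T.
  move=> /andP[ts st].
  have sT : 0 <= s <= T by rewrite (le_trans t0_ge0 ts) (le_trans st t1T).
  by split; [exact: (flow_displacement _ A0 sg1 hw hF)|
             exact: (flow_displacement _ A0 sg1 hv hG)].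
have step B : 0 <= B -> P B -> P (E + B / 2).
  move=> B0 PB s x /andP[ts st].
  apply: norm_le_coord => i; rewrite coordB.
  pose a := 1 + `|x| / L.
  pose g (r : R) := a * (delta + Phi * (r - t0) + B / 2 * expR (kappa * (r - t0))).
  pose dg (r : R) := a * (Phi + B / 2 * (kappa * expR (kappa * (r - t0)))).
  have hg (r : R) : is_derive r (1 : R) g (dg r).
    have h1 : is_derive r (1 : R) (fun r => kappa * (r - t0)) kappa.
      have -> : (fun r => kappa * (r - t0)) = (kappa \*: (@id R - cst t0)) by [].
      by apply: is_derive_eq; rewrite subr0 /GRing.scale/= mulr1.
    have h2 : is_derive r (1 : R) (fun r => Phi * (r - t0)) Phi.
      have -> : (fun r => Phi * (r - t0)) = (Phi \*: (@id R - cst t0)) by [].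
      by apply: is_derive_eq; rewrite subr0 /GRing.scale/= mulr1.
    have h3 := @is_derive1_comp _ expR (fun r => kappa * (r - t0)) r _ _
      (is_derive_expR _) h1.
    have -> : g = a \*: ((cst delta + (fun r => Phi * (r - t0))) +
      (B / 2) \*: (expR \o (fun r => kappa * (r - t0)))) by [].
    by apply: is_derive_eq; rewrite add0r /dg /GRing.scale/= [_ * kappa]mulrC.
  have hf (r : R) : is_derive r (1 : R) (fun r => coord i (F r x) - coord i (G r x))
      (sg * velocity i (F r) w (F r x) - sg * velocity i (G r) v (G r x)).
    have [_ _ dF] := hF; have [_ _ dG] := hG.
    exact: (is_deriveB (dF i r x) (dG i r x)).
  have : `|coord i (F s x) - coord i (G s x)| <= g s.
    apply: (derive_comparison ts hf hg).
    - move=> r /andP[tr rs].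
      have tr1 : t0 <= r <= t1 by rewrite tr (le_trans rs).
      have rT : 0 <= r <= T.
        by rewrite (le_trans t0_ge0 tr) (le_trans rs)// (le_trans st).
      rewrite -mulrBr normrM.
      have [mF _ _] := hF; have [mG _ _] := hG.
      have split_vel : velocity i (F r) w (F r x) - velocity i (G r) v (G r x) =
          velocity i (F r) w (F r x) - velocity i (G r) w (G r x) +
          velocity i (G r) (fun y => w y - v y) (G r x).
        by rewrite (velocityB _ _ A0 hw hv (mG r)); ring.
      apply: (@le_trans _ _ (1 * `|velocity i (F r) w (F r x) - velocity i (G r) v (G r x)|)).
        exact: ler_wpM2r.
      rewrite mul1r split_vel (le_trans (ler_normD _ _))//.
      have e0 : 0 <= B * expR (kappa * (r - t0)) by rewrite mulr_ge0// expR_ge0.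
      have D1 := velocity_drift i l x A0 e0 L0 VL hw (mF r) (mG r)
        (fun y => (disp r y tr1).1) (fun y => (disp r y tr1).2) (fun y => PB r y tr1).
      apply: (le_trans (lerD D1 (Hr i r x rT))).
      rewrite /dg -/a.
      have ha : 1 <= a by exact: a1.
      have : (64 * A * half_pow R l + 4 * M / L) * 1 <= (64 * A * half_pow R l + 4 * M / L) * a.
        rewrite ler_wpM2l// addr_ge0 ?mulr_ge0 ?invr_ge0 ?(ltW L0)//.
        exact: ltW (half_pow_gt0 _ _).
      have : 0 <= a * (B * expR (kappa * (r - t0))) by rewrite mulr_ge0// (le_trans _ ha).
      rewrite /Phi {3}/kappa; lra.
    - rewrite /g subrr !mulr0 expR0 addr0 mulr1 -coordB.
      apply: (le_trans (coord_le_norm _ _)); apply: (le_trans (H0 x)).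
      have ha : 0 <= a := le_trans ler01 (a1 x).
      by rewrite -/a mulrC ler_wpM2l// lerDl divr_ge0.
  have ha : 0 <= a := le_trans ler01 (a1 x).
  move/le_trans; apply; rewrite /g -/a mulrC ler_wpM2r//.
  rewrite [leRHS]mulrDl lerD//.
  have hs : delta + Phi * (s - t0) <= E.
    rewrite lerD2l ler_wpM2l//; move: ts st t0_ge0 t1T; lra.
  apply: (le_trans hs); rewrite ler_peMr ?e1//.
  apply: le_trans hs; rewrite addr_ge0// mulr_ge0 ?subr_ge0//.
have E0 : 0 <= T -> 0 <= E by move=> T0; rewrite addr_ge0 ?mulr_ge0.
move=> s x /[dup] hs /andP[ts st].
have T0 : 0 <= T by move: ts st t0_ge0 t1T; lra.
(* The a priori bound that starts the iteration: each flow moves a point by at most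
   [(32 * A + M) * T]. *)
pose B0 := 2 * ((32 * A + M) * T).
have B0_ge0 : 0 <= B0 by rewrite !mulr_ge0// addr_ge0// mulr_ge0.
have iter k : P (2 * E + B0 * half_pow R k).
  elim: k => [|k IH].
    move=> r y hr; have [h1 h2] := disp r y hr.
    rewrite (_ : F r y - G r y = (F r y - y) - (G r y - y)); last first.
      by rewrite opprB addrA subrK.
    apply: (le_trans (ler_normB _ _)); apply: (le_trans (lerD h1 h2)).
    have tr : t0 <= r by case/andP: hr.
    apply: (@le_trans _ _ (B0 * 1 * 1)); first by rewrite /B0; lra.
    rewrite ler_pM ?ler_pM//; first by rewrite mulr1.
      by rewrite /half_pow expr0 mulr1 lerDr mulr_ge0// E0.
    exact: e1.
  rewrite (_ : 2 * E + _ = E + (2 * E + B0 * half_pow R k) / 2); last first.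
    by rewrite half_powS; field.
  apply: step => //; rewrite addr_ge0//; first by rewrite mulr_ge0 ?E0.
  by rewrite mulr_ge0// ltW// half_pow_gt0.
apply/ler_addgt0Pr => e e0.
pose c := expR (kappa * (s - t0)) * (1 + `|x| / L).
have c0 : 0 < c by rewrite mulr_gt0 ?expR_gt0// (lt_le_trans _ (a1 x)).
have [k hk] : exists k, half_pow R k <= e / (c * (B0 + 1)).
  by apply: half_pow_small; rewrite divr_gt0// mulr_gt0// ltr_wpDl.
apply: (le_trans (iter k s x hs)).
have hc : half_pow R k * (c * (B0 + 1)) <= e by rewrite -ler_pdivlMr// mulr_gt0// ltr_wpDl.
have hp : 0 <= half_pow R k * c by rewrite mulr_ge0 ?ltW// half_pow_gt0.
move: hc hp; rewrite /c; clear; clearbody E B0.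
move: (expR _) (1 + _) (half_pow _ _) => X Y h; lra.
Qed.

(** * Convergence of the flows *)

(** With this density [integrable_kernel] says that the kernel cut off at radius [r] is integrable,
    hence an admissible test function. *)
Lemma density_indic (R : realType) (P : plane R -> plane R) z (r : R) :
  measure_preserving (leb2 R) P -> 0 <= r ->
  density (leb2 R) 1 (4 * r ^+ 2) (\1_((fun y => z - P y) @^-1` box r) : plane R -> R).
Proof.
move=> hP r0; have hs := measure_preserving_spread z hP.
have mD : measurable ((fun y => z - P y) @^-1` box r).
  by rewrite -[X in measurable X]setTI; apply: hs.1 => //; exact: measurable_box.
split; first exact: measurable_indic.
  by move=> y; rewrite indicE; case: (_ \in _); rewrite ?normr1 ?normr0.
under eq_integral => y _ do rewrite ger0_norm//.
by rewrite integral_indic// setIT; exact: hs.2.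
Qed.

(** The kernel decays like [1 / |x|] and is not integrable at infinity. Its part within radius [r]
    is a test function for the weak-star convergence; the rest contributes at most [2 * M / r], and
    [r] is chosen to make this at most [e / 2]. *)
Lemma residual_cvg0 (R : realType) (A M : R) (w : plane R -> R)
    (wn : nat -> plane R -> R) (P : plane R -> plane R) i z (e : R) :
  0 <= A -> density (leb2 R) A M w -> (forall n, density (leb2 R) A M (wn n)) ->
  measure_preserving (leb2 R) P ->
  weak_star_cvg (leb2 R) [set: plane R] wn w -> 0 < e ->
  \forall n \near \oo, `|velocity i P (fun y => wn n y - w y) z| <= e.
Proof.
move=> A0 hw hwn hP wcvg e0; have M0 := density_ge0 hw.
have hs := measure_preserving_spread z hP.
pose r := 2 * (2 * M) / e + 1.
have r_gt0 : 0 < r by rewrite ltr_wpDl// divr_ge0 ?mulr_ge0// ltW.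
pose D := (fun y => z - P y) @^-1` box r.
have mD : measurable D.
  by rewrite -[X in measurable X]setTI; apply: hs.1 => //; exact: measurable_box.
pose g y := kernel i (z - P y) * \1_D y.
have hD := density_indic z hP (ltW r_gt0).
have mg : measurable_fun setT g by apply: measurable_kernelM; [exact: hs.1|case: hD].
have ig : (leb2 R).-integrable setT (EFin \o g).
  exact: (integrable_kernel i z ler01 hD hP).
have iu (u : plane R -> R) : density (leb2 R) A M u ->
    (leb2 R).-integrable setT (fun y => (u y * g y)%:E).
  move=> hu; have [mu uA _] := hu.
  have := integrable_kernel i z A0 hu hP; apply: le_integrable => //.
    by apply/measurable_EFinP; exact: measurable_funM.
  move=> y _; rewrite /g lee_fin mulrCA mulrA normrM indicE.
  by case: (_ \in _); rewrite ?normr1 ?mulr1 ?normr0 ?mulr0.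
have /cvgrPdist_le/(_ (e / 2)) := wcvg g ig.
move/(_ (divr_gt0 e0 (ltr0n _ 2))); apply: filterS => n hn.
have huB := densityB (hwn n) hw.
pose K y := kernel i (z - P y) * (wn n y - w y).
have iK : (leb2 R).-integrable setT (EFin \o K).
  by apply: (integrable_kernel i z _ huB hP); rewrite mulr_ge0.
have iK1 : (leb2 R).-integrable setT (fun y => (wn n y * g y - w y * g y)%:E).
  by have := integrableB measurableT (iu _ (hwn n)) (iu _ hw).
have iK2 : (leb2 R).-integrable setT (EFin \o (fun y => K y - (wn n y * g y - w y * g y))).
  by have := integrableB measurableT iK iK1.
have -> : velocity i P (fun y => wn n y - w y) z =
    \int[leb2 R]_y (wn n y * g y - w y * g y) +
    \int[leb2 R]_y (K y - (wn n y * g y - w y * g y)).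
  rewrite -RintegralD//; apply: eq_Rintegral => y _; rewrite /K; ring.
rewrite (splitr e) (le_trans (ler_normD _ _))// lerD//.
  have := RintegralB measurableT (iu _ (hwn n)) (iu _ hw).
  by move=> /= ->; rewrite distrC.
apply: Rintegral_norm_le => //.
have mC : measurable (~` D) by exact: measurableC.
rewrite (_ : (\int[_]_x _)%E = (\int[leb2 R]_(y in ~` D) `|K y|%:E)%E); last first.
  rewrite [RHS]integral_mkcond; apply: eq_integral => y _.
  rewrite patchE /g indicE /K; have [yD|yD] := boolP (y \in ~` D).
    rewrite in_setC in yD; rewrite (negbTE yD) !mulr0 subr0 subr0//.
  rewrite in_setC negbK in yD; rewrite yD mulr1.
  by rewrite (_ : _ - _ = 0) ?normr0//; ring.
have := kernel_tail i huB hs.1 mC r_gt0 _.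
move=> /(_ _)/le_trans; apply.
  by move=> y /negP; rewrite /D /= /box /= -ltNge => /ltW.
rewrite lee_fin ler_pdivrMr// /r mulrDr mulr1.
rewrite (_ : e / 2 * _ = 2 * M); first lra.
by field; rewrite gt_eqF.
Qed.

(** Convergence at each [(s, z)] becomes uniform on a compact set by equicontinuity in [n]: the
    modulus of continuity depends only on [A] and [M], and the flow has speed at most [V]. *)
Lemma residual_uniform (R : realType) (A M sg : R) (w : plane R -> R)
    (wn : nat -> plane R -> R) (G : R -> plane R -> plane R) i (T r e : R) :
  0 <= A -> `|sg| <= 1 -> density (leb2 R) A M w -> (forall n, density (leb2 R) A M (wn n)) ->
  lagrangian_flow sg w G ->
  weak_star_cvg (leb2 R) [set: plane R] wn w -> 0 < e ->
  \forall n \near \oo, forall (s : R) (z : plane R), 0 <= s <= T -> `|z| <= r ->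
    `|velocity i (G s) (fun y => wn n y - w y) z| <= e.
Proof.
move=> A0 sg1 hw hwn hG wcvg e0; have M0 := density_ge0 hw.
have [mG _ _] := hG.
pose V := 32 * A + M; have V0 : 0 <= V by rewrite addr_ge0// mulr_ge0.
pose C : set (R * plane R) := `[0, T] `*` (`[- r, r] `*` `[- r, r]).
have cC : compact C.
  by apply: compact_setX; [exact: segment_compact|apply: compact_setX; exact: segment_compact].
have /compact_near_coveringP cov := cC.
have := cov nat \oo (fun n p => `|velocity i (G p.1) (fun y => wn n y - w y) p.2| <= e) _.
case.
  move=> [s0 z0] _ /=.
  (* [l] and then [d] make each of the two parts of the modulus at most [e / 3]; the remaining third
     is for the value at the centre [(s0, z0)]. *)
  have [l hl] : exists l, half_pow R l <= e / (3 * (128 * A + 1)).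
    by apply: half_pow_small; rewrite divr_gt0// mulr_gt0// ltr_wpDl// mulr_ge0.
  pose Q := 2 * (1 + V) * (2 * M + 16 * (2 * A) * l%:R) + 1.
  have Q0 : 0 < Q by rewrite ltr_wpDl// !mulr_ge0// addr_ge0// !mulr_ge0.
  pose d := e / (3 * Q); have d0 : 0 < d by rewrite divr_gt0// mulr_gt0.
  have e3 : 0 < e / 3 by rewrite divr_gt0.
  have hpt := residual_cvg0 i z0 A0 hw hwn (mG s0) wcvg e3.
  exists ([set p | `|s0 - p.1| < d /\ `|z0 - p.2| < d],
          [set n | `|velocity i (G s0) (fun y => wn n y - w y) z0| <= e / 3]).
    split => //=; exists (ball s0 d, ball z0 d) => /=.
      by split; exact: nbhsx_ballx.
    by move=> [s z] /= []; rewrite -!ball_normE.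
  move=> [[s z] n] /= [[hs hz] hn].
  have huB := densityB (hwn n) hw.
  have A20 : 0 <= 2 * A by rewrite mulr_ge0.
  have dd0 : 0 <= (1 + V) * d by apply: mulr_ge0; [exact: addr_ge0|exact: ltW].
  have key := velocity_log_lipschitz (A := 2 * A) (M := 2 * M) i l A20 dd0 huB (mG s) (mG s0).
  have {key}/(_ z z0) key := key.
  have /key {}key : forall y, `|(z - G s y) - (z0 - G s0 y)| <= (1 + V) * d.
    move=> y; rewrite (_ : _ - _ = (z - z0) - (G s y - G s0 y)); last first.
      by rewrite [LHS]surjective_pairing [RHS]surjective_pairing /=; congr (_, _); ring.
    rewrite (le_trans (ler_normB _ _))// mulrDl mul1r lerD//; first by rewrite distrC ltW.
    apply: (le_trans (flow_speed s s0 y A0 sg1 hw hG)).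
    by rewrite ler_wpM2l// distrC ltW.
  have : `|velocity i (G s) (fun y => wn n y - w y) z| <=
     `|velocity i (G s0) (fun y => wn n y - w y) z0| +
     `|velocity i (G s) (fun y => wn n y - w y) z - velocity i (G s0) (fun y => wn n y - w y) z0|.
    by rewrite -lerBlDl lerB_dist.
  move=> /le_trans; apply; apply: (le_trans (lerD hn key)).
  have t1 : 64 * (2 * A) * half_pow R l <= e / 3.
    move: hl; rewrite ler_pdivlMr; last by rewrite mulr_gt0// ltr_wpDl// mulr_ge0.
    have := half_pow_gt0 R l; move: (half_pow R l) => h h0; nra.
  have t2 : 2 * ((1 + V) * d) * (2 * M + 16 * (2 * A) * l%:R) <= e / 3.
    rewrite (_ : 2 * _ * _ = d * (Q - 1)); last by rewrite /Q; ring.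
    rewrite (_ : e / 3 = d * Q); last by rewrite /d invfM mulrA divfK// gt_eqF.
    by rewrite ler_wpM2l ?(ltW d0)// gerBl.
  lra.
move=> N _ HN; exists N => // n /= Nn s z hs hz.
apply: (HN n Nn (s, z)); split => /=; first by rewrite in_itv.
by move: hz; rewrite plane_norm_le !ler_norml !in_itv /= => /andP.
Qed.

(** For [|x| <= r] the uniform estimate applies on a box enlarged by the displacement of the flow.
    For larger [x] the crude velocity bound is below [theta * |x| / L], which is how [r] is
    chosen. *)
Lemma residual_weighted (R : realType) (A M sg : R) (w : plane R -> R)
    (wn : nat -> plane R -> R) (G : R -> plane R -> plane R) (T L theta : R) :
  0 <= A -> `|sg| <= 1 -> density (leb2 R) A M w -> (forall n, density (leb2 R) A M (wn n)) ->
  lagrangian_flow sg w G ->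
  weak_star_cvg (leb2 R) [set: plane R] wn w -> 0 < L -> 0 < theta ->
  \forall n \near \oo, forall i (s : R) (x : plane R), 0 <= s <= T ->
    `|velocity i (G s) (fun y => wn n y - w y) (G s x)| <= theta * (1 + `|x| / L).
Proof.
move=> A0 sg1 hw hwn hG wcvg L0 th0; have M0 := density_ge0 hw.
have [mG _ _] := hG.
pose r := L * (32 * (2 * A) + 2 * M) / theta.
have unif i := residual_uniform i T (r + (32 * A + M) * T) A0 sg1 hw hwn hG wcvg th0.
apply: filterS2 (unif true) (unif false) => n h1 h2 i s x sT.
have [xr|rx] := leP `|x| r; last first.
  have huB := densityB (hwn n) hw.
  apply: (le_trans (velocity_bound i _ _ huB (mG s))); first by rewrite mulr_ge0.
  move: rx; rewrite /r ltr_pdivrMr// => rx.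
  apply: (@le_trans _ _ (theta * (`|x| / L))).
    by rewrite [leRHS]mulrA ler_pdivlMr// [leLHS]mulrC [leRHS]mulrC ltW.
  by rewrite ler_wpM2l ?(ltW th0)// lerDr.
apply: (@le_trans _ _ theta); last by rewrite ler_peMr ?(ltW th0)// lerDl divr_ge0// ltW.
have xG : `|G s x| <= r + (32 * A + M) * T.
  rewrite -[G s x](subrK x) addrC (le_trans (ler_normD _ _))// lerD//.
  exact: (flow_displacement _ A0 sg1 hw hG).
by case: i; [exact: h1|exact: h2].
Qed.

(** Because [(3 / 2) / 2 = 3 / 4 < 1]. The time step will be so short that each unit of [l] costs a
    factor of at most [3 / 2]; any number strictly between 1 and 2 would do. *)
Lemma growth_vs_decay (R : realType) (c e : R) : 0 < e -> 0 <= c ->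
  exists l, c * half_pow R l * (3 / 2) ^+ l.+1 <= e.
Proof.
move=> e0 c0.
have [l hl] : exists l, (3 / 4 : R) ^+ l <= e / (2 * (c + 1)).
  have d0 : 0 < e / (2 * (c + 1)) by rewrite divr_gt0// mulr_gt0// ltr_wpDl.
  by apply: expr_small => //; lra.
exists l.
have -> : c * half_pow R l * (3 / 2) ^+ l.+1 = c * (3 / 2) * (3 / 4) ^+ l.
  rewrite exprS (_ : 3 / 4 = 2^-1 * (3 / 2) :> R); last by field.
  by rewrite /half_pow; move: (3 / 2) => X; rewrite exprMn; ring.
have p0 : 0 <= (3 / 4 : R) ^+ l by rewrite exprn_ge0.
move: hl; rewrite ler_pdivlMr; last by rewrite mulr_gt0// ltr_wpDl.
move: ((3 / 4) ^+ l) p0 => X X0; nra.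
Qed.

(** All large [L] are included because each further time step needs [L] large compared with its own
    error; the threshold for [n] may depend on [L]. *)
Definition flows_close (R : realType) (F : nat -> R -> plane R -> plane R)
    (G : R -> plane R -> plane R) (t : R) : Prop :=
  forall e : R, 0 < e -> exists L0 : R, 0 < L0 /\ forall L, L0 <= L ->
    \forall n \near \oo, forall x, `|F n t x - G t x| <= e * (1 + `|x| / L).

(* The factor exp(O(l) tau) of the Gronwall estimate is beaten by the error 2 ^ -l
   only on a short time interval, whose length does not depend on l. *)
Lemma flows_close_step (R : realType) (A M sg : R) (w : plane R -> R)
    (wn : nat -> plane R -> R) (F : nat -> R -> plane R -> plane R)
    (G : R -> plane R -> plane R) (T t0 t tau : R) :
  0 <= A -> `|sg| <= 1 -> density (leb2 R) A M w -> (forall n, density (leb2 R) A M (wn n)) ->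
  lagrangian_flow sg w G -> (forall n, lagrangian_flow sg (wn n) (F n)) ->
  weak_star_cvg (leb2 R) [set: plane R] wn w ->
  0 <= tau -> expR ((12 * (M + 16 * A) + 1) * tau) <= 3 / 2 ->
  0 <= t0 -> t0 <= t <= t0 + tau -> t <= T ->
  flows_close F G t0 -> flows_close F G t.
Proof.
move=> A0 sg1 hw hwn hG hF wcvg tau0 htau t0_ge0 /andP[t0t tt0] tT close e e0.
have M0 := density_ge0 hw.
have T0 : 0 <= T by rewrite (le_trans t0_ge0)// (le_trans t0t).
have e4 : 0 < e / 4 by rewrite divr_gt0.
have c0 : 0 <= 2 * (64 * A * T) by rewrite !mulr_ge0.
(* Four terms are each made at most [e / 4]: the near part by [l], the source by [theta], the
   distance at [t0] by [e / (8 * E)], the far part by [L]. The order matters, since [E] depends on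
   [l]. *)
have [l hl] := growth_vs_decay e4 c0.
pose E : R := (3 / 2) ^+ l.+1.
have E0 : 0 < E by rewrite exprn_gt0// divr_gt0.
pose theta := e / (8 * (T + 1) * E).
have T1 : 0 < T + 1 by rewrite ltr_wpDl.
have th0 : 0 < theta by rewrite divr_gt0// !mulr_gt0.
have d0 : 0 < e / (8 * E) by rewrite divr_gt0// mulr_gt0.
have [L1 [L1_gt0 hL1]] := close _ d0.
(* The first summand meets the condition of [flow_gronwall] on [L]; the second gives
   [8 * M * T * E / L <= e / 4]. *)
pose L2 := 4 * ((32 * A + M) * T) + 32 * M * T * E / e + 1.
have V0 : 0 <= 4 * ((32 * A + M) * T) by rewrite !mulr_ge0// addr_ge0// mulr_ge0.
have Q0 : 0 <= 32 * M * T * E / e by rewrite divr_ge0 ?mulr_ge0// ltW.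
exists (L1 + L2); split; first by rewrite addr_gt0// ltr_wpDl// addr_ge0.
move=> L hL.
have L1L : L1 <= L by move: hL; rewrite /L2; lra.
have L_gt0 : 0 < L := lt_le_trans L1_gt0 L1L.
apply: filterS2 (hL1 L L1L) (residual_weighted T A0 sg1 hw hwn hG wcvg L_gt0 th0).
move=> n hn hr x.
have VL : 4 * ((32 * A + M) * T) <= L by move: hL L1_gt0; rewrite /L2; lra.
have t01 : t0 <= t <= t by rewrite t0t lexx.
apply: (le_trans (flow_gronwall l A0 sg1 (hwn n) hw (hF n) hG t0_ge0 tT L_gt0 VL
  (ltW d0) (ltW th0) hn hr x t01)).
have a0 : 0 <= 1 + `|x| / L by rewrite addr_ge0// divr_ge0// ltW.
rewrite ler_wpM2r//.
(* The exponent is at most [l.+1] times [(12 * (M + 16 * A) + 1) * tau]. *)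
have hexp : expR ((12 * (M + 16 * A * l%:R) + 1) * (t - t0)) <= E.
  apply: (@le_trans _ _ (expR ((12 * (M + 16 * A) + 1) * tau) ^+ l.+1)); last first.
    by rewrite lerXn2r// ?nnegrE ?expR_ge0// divr_ge0.
  rewrite -expRM_natl ler_expR -natr1 [leRHS]mulrA; apply: ler_pM.
  - by rewrite addr_ge0// mulr_ge0// addr_ge0// !mulr_ge0.
  - by rewrite subr_ge0.
  - have : 0 <= M * l%:R by rewrite mulr_ge0.
    have := ler0n R l; nra.
  - by rewrite lerBlDl.
have pos : 0 <= 2 * (e / (8 * E) + (64 * A * half_pow R l + 4 * M / L + theta) * T).
  have h0 := ltW (half_pow_gt0 R l); have L_ge0 := ltW L_gt0; have th_ge0 := ltW th0.
  by rewrite mulr_ge0// addr_ge0 ?(ltW d0)// mulr_ge0// !addr_ge0// ?divr_ge0// mulr_ge0// mulr_ge0.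
apply: (le_trans (ler_wpM2l pos hexp)).
have -> : 2 * (e / (8 * E) + (64 * A * half_pow R l + 4 * M / L + theta) * T) * E =
  e / 4 + 2 * (64 * A * T) * half_pow R l * E + 8 * M * T * E / L + e / 4 * (T / (T + 1)).
  by rewrite /theta; field; rewrite !gt_eqF.
have h1 : 8 * M * T * E / L <= e / 4.
  rewrite ler_pdivrMr//.
  have : 32 * M * T * E / e <= L by move: hL L1_gt0; rewrite /L2; lra.
  by rewrite ler_pdivrMr//; lra.
have h2 : T / (T + 1) <= 1 by rewrite ler_pdivrMr// mul1r lerDl.
have h3 : e / 4 * (T / (T + 1)) <= e / 4 by rewrite ler_piMr// ltW.
move: hl; rewrite -/E => hl; lra.
Qed.

Lemma flows_close0 (R : realType) (sg : R) (w : plane R -> R)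
    (wn : nat -> plane R -> R) (F : nat -> R -> plane R -> plane R)
    (G : R -> plane R -> plane R) :
  lagrangian_flow sg w G -> (forall n, lagrangian_flow sg (wn n) (F n)) ->
  flows_close F G 0.
Proof.
move=> [_ G0 _] hF e e0; exists 1; split => // L L1; apply: nearW => n x.
have [_ F0 _] := hF n; rewrite F0 G0 subrr normr0 mulr_ge0 ?(ltW e0)//.
by rewrite addr_ge0// divr_ge0// (le_trans ler01 L1).
Qed.

(** Finitely many steps of the fixed length [tau] reach [t], and at a fixed [x] the weight is
    bounded by the constant [1 + |x|]. *)
Lemma flow_cvg (R : realType) (A M sg : R) (w : plane R -> R)
    (wn : nat -> plane R -> R) (F : nat -> R -> plane R -> plane R)
    (G : R -> plane R -> plane R) (t : R) x :
  0 <= A -> `|sg| <= 1 -> density (leb2 R) A M w -> (forall n, density (leb2 R) A M (wn n)) ->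
  lagrangian_flow sg w G -> (forall n, lagrangian_flow sg (wn n) (F n)) ->
  weak_star_cvg (leb2 R) [set: plane R] wn w -> 0 <= t ->
  (fun n => F n t x) @ \oo --> G t x.
Proof.
move=> A0 sg1 hw hwn hG hF wcvg t0.
have M0 := density_ge0 hw.
pose c := 12 * (M + 16 * A) + 1.
have c0 : 0 < c by rewrite ltr_wpDl// mulr_ge0// addr_ge0// mulr_ge0.
pose tau := ln (3 / 2 : R) / c.
have tau0 : 0 < tau by rewrite divr_gt0// ln_gt0//; lra.
have htau : expR (c * tau) <= 3 / 2.
  by rewrite /tau mulrC divfK ?gt_eqF// lnK// posrE divr_gt0.
have close k : forall s, 0 <= s -> s <= k%:R * tau -> flows_close F G s.
  elim: k => [|k IH] s s0 sk.
    have -> : s = 0 by apply/le_anti; rewrite s0 andbT; move: sk; rewrite mul0r.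
    exact: flows_close0 hG hF.
  have [sk'|ks] := leP s (k%:R * tau); first exact: IH.
  have kt0 : 0 <= k%:R * tau by rewrite mulr_ge0// ltW.
  apply: (flows_close_step A0 sg1 hw hwn hG hF wcvg (ltW tau0) htau kt0 _ (lexx s)).
    by rewrite (ltW ks)/=; move: sk; rewrite -natr1 mulrDl mul1r.
  exact: IH.
have [k hk] : exists k : nat, t <= k%:R * tau.
  exists (Num.truncn (t / tau)).+1; rewrite -ler_pdivrMr//.
  exact: ltW (truncnS_gt _).
apply/cvgrPdist_le => e e0.
have ax : 0 < 1 + `|x| by rewrite ltr_wpDr.
have [L0 [L0_gt0 hL]] := close k t t0 hk _ (divr_gt0 e0 ax).
have L01 : L0 <= L0 + 1 by rewrite lerDl.
have := hL _ L01.
apply: filterS => n /(_ x) h; rewrite distrC (le_trans h)//.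
rewrite mulrAC ler_pdivrMr// ler_wpM2l ?(ltW e0)// lerD2l ler_pdivrMr ?addr_gt0//.
by rewrite ler_peMr// lerDr ltW.
Qed.

(** * Uniform boundedness *)

Lemma ess_bounded_integral_le d (T : measurableType d) (R : realType)
    (mu : {measure set T -> \bar R}) (f g : T -> R) (N c : R) :
  measurable_fun setT f -> 0 <= N -> {ae mu, forall x, `|f x| <= N} ->
  measurable_fun setT g -> (\int[mu]_x `|g x|%:E <= c%:E)%E ->
  (\int[mu]_x `|f x * g x|%:E <= (N * c)%:E)%E.
Proof.
move=> mf N0 fN mg gc.
have mng : measurable_fun setT (fun x => `|g x|%:E).
  by apply/measurable_EFinP; exact: measurableT_comp.
apply: (@le_trans _ _ (\int[mu]_x (N%:E * `|g x|%:E))%E).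
  apply: ae_ge0_le_integral => //.
  - apply/measurable_EFinP; apply: measurableT_comp => //; exact: measurable_funM.
  - by move=> x _; rewrite mule_ge0.
  - exact: measurable_funeM.
  - apply: filterS fN => x fx _.
    by rewrite normrM -EFinM lee_fin ler_wpM2r.
by rewrite ge0_integralZl_EFin// EFinM lee_wpmul2l.
Qed.

Lemma integrable_norm_lty d (T : measurableType d) (R : realType)
    (mu : {measure set T -> \bar R}) (g : T -> R) :
  mu.-integrable setT (EFin \o g) -> exists c : R, (\int[mu]_x `|g x|%:E = c%:E)%E.
Proof.
move=> /[dup] ig /integrableP[mg gfin].
exists (fine (\int[mu]_x `|g x|%:E)); rewrite fineK// ge0_fin_numE//.
exact: integral_ge0.
Qed.

Lemma ess_bounded_integrable d (T : measurableType d) (R : realType)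
    (mu : {measure set T -> \bar R}) (f g : T -> R) (N : R) :
  measurable_fun setT f -> 0 <= N -> {ae mu, forall x, `|f x| <= N} ->
  mu.-integrable setT (EFin \o g) -> mu.-integrable setT (EFin \o (fun x => f x * g x)).
Proof.
move=> mf N0 fN ig; have [c gc] := integrable_norm_lty ig.
have mg : measurable_fun setT g by apply/measurable_EFinP; exact: measurable_int ig.
apply/integrableP; split; first by apply/measurable_EFinP; exact: measurable_funM.
have := @ess_bounded_integral_le _ _ _ mu f g N c mf N0 fN mg.
rewrite gc => /(_ (lexx _)) h; exact: le_lt_trans h (ltry _).
Qed.

Lemma ess_bounded_Rintegral_le d (T : measurableType d) (R : realType)
    (mu : {measure set T -> \bar R}) (f g : T -> R) (N c : R) :
  measurable_fun setT f -> 0 <= N -> {ae mu, forall x, `|f x| <= N} ->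
  mu.-integrable setT (EFin \o g) -> (\int[mu]_x `|g x|%:E <= c%:E)%E ->
  `|\int[mu]_x (f x * g x)| <= N * c.
Proof.
move=> mf N0 fN ig gc.
apply: Rintegral_norm_le; first exact: ess_bounded_integrable mf N0 fN ig.
apply: ess_bounded_integral_le => //.
by apply/measurable_EFinP; exact: measurable_int ig.
Qed.

(** The test function is [f] itself on the set where [|f| > 3 / 4 * N], normalised in L1: there
    [f ^ 2 >= 3 / 4 * N * |f|]. This set is not negligible, so the normalising constant is
    positive. *)
Lemma norming_function d (T : measurableType d) (R : realType)
    (mu : {measure set T -> \bar R}) (f : T -> R) (N : R) :
  mu.-integrable setT (EFin \o f) -> 0 < N -> {ae mu, forall x, `|f x| <= N} ->
  ~ {ae mu, forall x, `|f x| <= 3 / 4 * N} ->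
  exists h : T -> R, [/\ mu.-integrable setT (EFin \o h),
    (\int[mu]_x `|h x|%:E <= 1)%E & 3 / 4 * N <= \int[mu]_x (f x * h x)].
Proof.
move=> intf N0 fN fbig.
have mf : measurable_fun setT f by apply/measurable_EFinP; exact: measurable_int intf.
have mnf : measurable_fun setT (fun x => `|f x|) by exact: measurableT_comp.
pose E := (fun x => `|f x|) @^-1` `]3 / 4 * N, +oo[.
have mE : measurable E by rewrite -[X in measurable X]setTI; exact: mnf.
have EP x : E x <-> 3 / 4 * N < `|f x| by rewrite /E /= in_itv/= andbT.
pose k x := `|f x| * \1_E x.
have mk : measurable_fun setT k.
  by apply: measurable_funM => //; exact: measurable_indic.
have k0 x : 0 <= k x by rewrite mulr_ge0.
have kf x : k x <= `|f x|.
  by rewrite /k indicE; case: (x \in E); rewrite ?mulr1 ?mulr0.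
have ik : mu.-integrable setT (EFin \o k).
  apply: le_integrable intf => //; first exact/measurable_EFinP.
  by move=> x _; rewrite lee_fin ger0_norm.
pose c := \int[mu]_x k x.
have cE : (\int[mu]_x (k x)%:E = c%:E)%E.
  by rewrite /c /Rintegral fineK//; exact: integrable_fin_num ik.
have c_ge0 : 0 <= c by apply: Rintegral_ge0.
have c0 : 0 < c.
  rewrite lt0r c_ge0 andbT; apply/eqP => c0; apply: fbig.
  have : ae_eq mu setT (EFin \o k) (cst 0%E).
    apply/(ae_eq_integral_abs mu measurableT); first exact/measurable_EFinP.
    by under eq_integral do rewrite /= ger0_norm//; rewrite cE c0.
  apply: filterS => x /(_ I) /= [] kx.
  rewrite leNgt; apply/negP => xE.
  move: kx; rewrite /k indicE (_ : x \in E) ?mulr1; last by rewrite inE; exact/EP.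
  move=> fx; move: xE; rewrite fx ltNge mulr_ge0// ?ltW//.
pose h x := f x * \1_E x / c.
have mh : measurable_fun setT h.
  by do 2 apply: measurable_funM => //; exact: measurable_indic.
have hk x : `|h x| = c^-1 * k x.
  have i0 : 0 <= \1_E x :> R by [].
  by rewrite /h !normrM normfV (gtr0_norm c0) (ger0_norm i0) mulrC.
have ch : (\int[mu]_x `|h x|%:E <= 1)%E.
  under eq_integral do rewrite hk EFinM.
  rewrite ge0_integralZl_EFin ?invr_ge0//; last 2 first.
  - by move=> x _; rewrite lee_fin.
  - exact/measurable_EFinP.
  by rewrite cE -EFinM mulVf// gt_eqF.
exists h; split => //.
  apply/integrableP; split; first exact/measurable_EFinP.
  exact: le_lt_trans ch (ltry _).
have ih : mu.-integrable setT (EFin \o h).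
  apply/integrableP; split; first exact/measurable_EFinP.
  exact: le_lt_trans ch (ltry _).
have ifh := ess_bounded_integrable mf (ltW N0) fN ih.
have ik2 : mu.-integrable setT (fun x => (3 / 4 * N / c * k x)%:E).
  by under eq_fun do rewrite EFinM; exact: integrableZl.
rewrite (_ : 3 / 4 * N = \int[mu]_x (3 / 4 * N / c * k x)); last first.
  by rewrite RintegralZl// -/c divfK// gt_eqF.
apply: le_Rintegral => // x _.
have -> : f x * h x = (f x ^+ 2 * \1_E x) / c by rewrite /h; ring.
rewrite mulrAC ler_wpM2r ?invr_ge0// /k indicE.
have [xE|xE] := boolP (x \in E); last by rewrite !mulr0.
rewrite !mulr1 -real_normK ?num_real// expr2 ler_wpM2r//.
by move: xE; rewrite inE => /EP/ltW.
Qed.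

(** [N] is the essential supremum of [|f|]. Being positive, it exceeds [3 / 4 * N], which therefore
    is not an essential bound. *)
Lemma ess_sup_real d (T : measurableType d) (R : realType)
    (mu : {measure set T -> \bar R}) (f : T -> R) (c B : R) :
  0 <= c -> {ae mu, forall x, `|f x| <= B} -> ~ {ae mu, forall x, `|f x| <= c} ->
  exists N : R, [/\ c < N, {ae mu, forall x, `|f x| <= N} &
    ~ {ae mu, forall x, `|f x| <= 3 / 4 * N}].
Proof.
move=> c0 fB fc.
pose e := ess_sup mu (fun x => `|f x|%:E).
have eB : (e <= B%:E)%E by apply/ess_supP; apply: filterS fB => x; rewrite lee_fin.
have ce : (c%:E < e)%E.
  rewrite ltNge; apply/negP => /ess_supP h; apply: fc.
  by apply: filterS h => x; rewrite lee_fin.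
have ef : e \is a fin_num.
  by rewrite fin_numE; move: eB ce; case: e.
exists (fine e).
have cN : c < fine e by rewrite -lte_fin fineK.
split => //.
- by apply: filterS (ess_sup_ge mu (fun x => `|f x|%:E)) => x; rewrite -/e -lee_fin fineK.
- move=> h; have /ess_supP : {ae mu, forall x, (`|f x|%:E <= (3 / 4 * fine e)%:E)%E}.
    by apply: filterS h => x; rewrite lee_fin.
  rewrite -/e -{1}(fineK ef) lee_fin => h2.
  by move: cN c0 h2; lra.
Qed.

Lemma integrable_norm_leD d (T : measurableType d) (R : realType)
    (mu : {measure set T -> \bar R}) (f g : T -> R) (a b : R) :
  measurable_fun setT f -> measurable_fun setT g ->
  (\int[mu]_x `|f x|%:E <= a%:E)%E -> (\int[mu]_x `|g x|%:E <= b%:E)%E ->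
  (\int[mu]_x `|f x + g x|%:E <= (a + b)%:E)%E.
Proof.
move=> mf mg fa gb.
have mnf : measurable_fun setT (fun x => `|f x|%:E).
  by apply/measurable_EFinP; exact: measurableT_comp.
have mng : measurable_fun setT (fun x => `|g x|%:E).
  by apply/measurable_EFinP; exact: measurableT_comp.
apply: (@le_trans _ _ (\int[mu]_x (`|f x|%:E + `|g x|%:E))%E).
  apply: ge0_le_integral => //.
  - by apply/measurable_EFinP; apply: measurableT_comp => //; exact: measurable_funD.
  - exact: emeasurable_funD.
  - by move=> x _; rewrite -EFinD lee_fin ler_normD.
by rewrite ge0_integralD// EFinD leeD.
Qed.

(** Riesz-Fischer: the sum of the [|u k|] is integrable, hence finite almost everywhere, and it
    dominates all partial sums. *)
Lemma summable_L1_limit d (T : measurableType d) (R : realType)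
    (mu : {measure set T -> \bar R}) (u : nat -> T -> R) (a : nat -> R) :
  (forall k, measurable_fun setT (u k)) ->
  (forall k, (\int[mu]_x `|u k x|%:E <= (a k)%:E)%E) ->
  (forall k, a k <= 2^-1 ^+ k) ->
  exists g : T -> R, mu.-integrable setT (EFin \o g) /\
    forall e : R, 0 < e -> exists N, forall m, (N <= m)%N ->
      (\int[mu]_x `|g x - \sum_(j < m) u j x|%:E <= e%:E)%E.
Proof.
move=> mu_ ua a2.
have mnu k : measurable_fun setT (fun x => `|u k x|%:E).
  by apply/measurable_EFinP; exact: measurableT_comp.
pose S x := (\sum_(0 <= k <oo) `|u k x|%:E)%E.
pose G m x := \sum_(j < m) u j x.
have mG m : measurable_fun setT (G m) by exact: measurable_sum.
have mS : measurable_fun setT S by exact: ge0_emeasurable_sum.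
have S0 x : (0 <= S x)%E by exact: nneseries_ge0.
have iS : mu.-integrable setT S.
  apply/integrableP; split => //.
  under eq_integral do rewrite gee0_abs//.
  rewrite integral_nneseries//.
  have geo := @cvg_geometric_eseries_half R 2 0; rewrite expr0 divr1 in geo.
  apply: (@le_lt_trans _ _ 2%:E); last exact: ltry.
  rewrite -(cvg_lim _ geo)//; apply: lee_nneseries => k _.
    by move=> _; exact: integral_ge0.
  apply: (le_trans (ua k)); rewrite lee_fin (le_trans (a2 k))//.
  by rewrite addn1 natrX exprS invfM mulrA divff// mul1r exprVn.
(* The upper limit is measurable on the whole space and equals the sum of the series wherever [S] is
   finite. *)
pose g x := fine (limn_esup (fun m => (G m x)%:E)).
have mg : measurable_fun setT g.
  apply: measurableT_comp => //; apply: measurable_fun_limn_esup => m.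
  exact/measurable_EFinP.
have Gg x : S x \is a fin_num -> (fun m => (G m x)%:E) @ \oo --> (g x)%:E.
  move=> Sx.
  have cG : cvgn (fun m => G m x).
    rewrite (_ : (fun m => G m x) = series (fun k => u k x)); last first.
      by apply/funext => m; rewrite /series /= big_mkord.
    apply: normed_cvg; apply: nondecreasing_is_cvgn.
      apply: (@nondecreasing_series _ _ xpredT 0) => k _ _; exact: normr_ge0.
    exists (fine (S x)) => _ [m _ <-].
    rewrite -lee_fin fineK// /series /= -sumEFin.
    exact: nneseries_lim_ge.
  have cE : (fun m => (G m x)%:E) @ \oo --> (limn (fun m => G m x))%:E.
    by apply: cvg_EFin => //; exact: nearW.
  by rewrite /g is_cvg_limn_esupE ?(cvg_lim _ cE)//; apply/cvg_ex; eexists; exact: cE.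
have GS m x : (`|(G m x)%:E| <= S x)%E.
  apply: (@le_trans _ _ (\sum_(0 <= k < m) `|u k x|%:E)%E).
    by rewrite sumEFin lee_fin /G big_mkord ler_norm_sum.
  exact: nneseries_lim_ge.
have mGe m : measurable_fun setT (fun x => (G m x)%:E) by exact/measurable_EFinP.
have mge : measurable_fun setT (EFin \o g) by exact/measurable_EFinP.
have ae_cvg : {ae mu, forall x, setT x -> (fun m => (G m x)%:E) @ \oo --> (EFin \o g) x}.
  by apply: filterS (integrable_ae measurableT iS) => x /(_ I) Sx _; exact: Gg.
have dom : {ae mu, forall x, forall m, setT x -> (`|(G m x)%:E| <= S x)%E}.
  by apply: aeW => x m _; exact: GS.
have [ig cvg0 _] := dominated_convergence measurableT mGe mge ae_cvg iS dom.
exists g; split => // e e0.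
move/fine_cvgP: cvg0 => [cfin /cvgrPdist_le /(_ e e0) cdist].
have [N _ HN] := filterI cfin cdist.
exists N => m /HN [/= h1]; rewrite sub0r normrN => h2.
rewrite (_ : (\int[mu]_x _)%E = (\int[mu]_x `|(G m x)%:E - (g x)%:E|)%E); last first.
  by apply: eq_integral => x _; rewrite -EFinB abse_EFin distrC.
by rewrite -(fineK h1) lee_fin (le_trans _ h2)// ler_norm.
Qed.

(* Sokal's gliding hump: the signs are chosen one after the other so that no
   term cancels the sum of the previous ones. *)
Lemma weakly_bounded_Linfty d (T : measurableType d) (R : realType)
    (mu : {measure set T -> \bar R}) (f : nat -> T -> R) :
  (forall n, mu.-integrable setT (EFin \o f n)) ->
  (forall n, exists B : R, {ae mu, forall x, `|f n x| <= B}) ->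
  (forall g : T -> R, mu.-integrable setT (EFin \o g) ->
     exists C : R, forall n, `|\int[mu]_x (f n x * g x)| <= C) ->
  exists A : R, 0 <= A /\ forall n, {ae mu, forall x, `|f n x| <= A}.
Proof.
move=> intf bf weak; apply: contrapT => unb.
(* The [k]-th hump is higher than [4 ^ k] and gets the coefficient [3 ^ -k]: the products exceed
   [(4 / 3) ^ k], while all later coefficients sum to only [3 ^ -k / 2]. *)
have hump k : exists t : nat * R * (T -> R),
    [/\ 4 ^+ k < t.1.2, {ae mu, forall x, `|f t.1.1 x| <= t.1.2},
        mu.-integrable setT (EFin \o t.2), (\int[mu]_x `|t.2 x|%:E <= 1)%E &
        3 / 4 * t.1.2 <= \int[mu]_x (f t.1.1 x * t.2 x)].
  have k4 : 0 <= 4 ^+ k :> R by rewrite exprn_ge0.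
  have [n hn] : exists n, ~ {ae mu, forall x, `|f n x| <= 4 ^+ k}.
    by apply/existsNP => h; apply: unb; exists (4 ^+ k).
  have [B hB] := bf n.
  have [N [kN fN fbig]] := ess_sup_real k4 hB hn.
  have [h [ih h1 hN]] := norming_function (intf n) (le_lt_trans k4 kN) fN fbig.
  by exists (n, N, h).
have [t ht] := choice hump.
pose n k := (t k).1.1; pose N k := (t k).1.2; pose h k := (t k).2.
have mf k : measurable_fun setT (f k) by apply/measurable_EFinP; exact: measurable_int (intf k).
have mh k : measurable_fun setT (h k).
  by have [_ _ ih _ _] := ht k; apply/measurable_EFinP; exact: measurable_int ih.
pose a k : R := 3^-1 ^+ k.
have a0 k : 0 < a k by rewrite exprn_gt0.
pose eps k (g : T -> R) : R := if 0 <= \int[mu]_x (f (n k) x * g x) then 1 else -1.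
have eps1 k g : `|eps k g| = 1 by rewrite /eps; case: ifP; rewrite ?normrN normr1.
pose fix G k : T -> R :=
  if k is k'.+1 then fun x => G k' x + eps k' (G k') * a k' * h k' x else fun=> 0.
pose u k x := eps k (G k) * a k * h k x.
have GE k x : G k x = \sum_(j < k) u j x.
  by elim: k => [|k IH]; rewrite ?big_ord0// big_ord_recr/= -IH.
have GS k x : G k.+1 x = G k x + u k x by [].
have mu_ k : measurable_fun setT (u k) by exact: measurable_funM.
have ua k : (\int[mu]_x `|u k x|%:E <= (a k)%:E)%E.
  have [_ _ ih h1 _] := ht k.
  under eq_integral do rewrite !normrM eps1 mul1r (gtr0_norm (a0 k)) EFinM.
  rewrite ge0_integralZl_EFin ?(ltW (a0 k))//; last first.
    by apply/measurable_EFinP; exact: measurableT_comp.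
  by rewrite -[leRHS]mule1 lee_wpmul2l ?lee_fin ?(ltW (a0 k)).
have a2 k : a k <= 2^-1 ^+ k.
  by rewrite lerXn2r ?nnegrE ?invr_ge0// lef_pV2 ?posrE// ler_nat.
have [g [ig Gg]] := summable_L1_limit mu_ ua a2.
have mg : measurable_fun setT g by apply/measurable_EFinP; exact: measurable_int ig.
have mG k : measurable_fun setT (G k).
  by rewrite (_ : G k = fun x => \sum_(j < k) u j x); [exact: measurable_sum|exact/funext].
have iu k : mu.-integrable setT (EFin \o u k).
  apply/integrableP; split; first exact/measurable_EFinP.
  exact: le_lt_trans (ua k) (ltry _).
have iG k : mu.-integrable setT (EFin \o G k).
  elim: k => [|k IH]; first exact: integrable0.
  by have := integrableD measurableT IH (iu k).
(* The right side is the exact sum of the [a j] for [k < j <= k + p]. *)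
have tail k p : (\int[mu]_x `|G (k.+1 + p)%N x - G k.+1 x|%:E <=
    (a k / 2 - a (k + p)%N / 2)%:E)%E.
  elim: p => [|p IH].
    under eq_integral do rewrite addn0 subrr normr0.
    by rewrite integral0 addn0 subrr.
  rewrite (_ : a k / 2 - _ = (a k / 2 - a (k + p)%N / 2) + a (k.+1 + p)%N); last first.
    by rewrite addSn addnS /a exprS; field.
  rewrite addnS; under eq_integral => x _ do rewrite GS addrAC.
  by apply: integrable_norm_leD => //; exact: measurable_funB.
have gG k : (\int[mu]_x `|g x - G k.+1 x|%:E <= (a k / 2)%:E)%E.
  apply/lee_addgt0Pr => e e0; have [m hm] := Gg e e0.
  rewrite -EFinD addrC.
  have := hm (k.+1 + m)%N (leq_addl _ _); under eq_integral do rewrite -GE.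
  move=> h1.
  have h2 : (\int[mu]_x `|G (k.+1 + m)%N x - G k.+1 x|%:E <= (a k / 2)%:E)%E.
    by apply: (le_trans (tail k m)); rewrite lee_fin gerBl divr_ge0// ltW.
  have := integrable_norm_leD (measurable_funB mg (mG _)) (measurable_funB (mG _) (mG _)) h1 h2.
  by under eq_integral do rewrite addrA subrK.
have [C hC] := weak g ig.
(* The norming function provides [3 / 4], and the later terms take away at most [1 / 2]. *)
have big k : a k * N k / 4 <= C.
  have [kN fN ih h1 hN] := ht k; rewrite -/(N k) -/(n k) -/(h k) in kN fN ih h1 hN.
  have N0 : 0 <= N k by rewrite ltW// (le_lt_trans _ kN)// exprn_ge0.
  have ifg := ess_bounded_integrable (mf _) N0 fN ig.
  have ifG m := ess_bounded_integrable (mf _) N0 fN (iG m).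
  have ifh := ess_bounded_integrable (mf _) N0 fN ih.
  have igG : mu.-integrable setT (EFin \o (fun x => g x - G k.+1 x)).
    by have := integrableB measurableT ig (iG k.+1).
  have := ess_bounded_Rintegral_le (mf _) N0 fN igG (gG k).
  rewrite (_ : \int[mu]_x _ =
      \int[mu]_x (f (n k) x * g x) - \int[mu]_x (f (n k) x * G k.+1 x)); last first.
    rewrite -RintegralB//.
    by apply: eq_Rintegral => x _; rewrite mulrBr.
  have : 3 / 4 * N k * a k <= `|\int[mu]_x (f (n k) x * G k.+1 x)|.
    have -> : \int[mu]_x (f (n k) x * G k.+1 x) =
        \int[mu]_x (f (n k) x * G k x) + eps k (G k) * a k * \int[mu]_x (f (n k) x * h k x).
      rewrite -RintegralZl// -RintegralD//.
      - by apply: eq_Rintegral => x _ /=; ring.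
      - by have := integrableZl measurableT (eps k (G k) * a k) ifh.
    have hN' : 3 / 4 * N k * a k <= a k * \int[mu]_x (f (n k) x * h k x).
      by rewrite mulrC ler_wpM2l// ltW.
    rewrite /eps; case: ifPn => sgn.
      rewrite mul1r (le_trans hN')// (le_trans _ (ler_norm _))// lerDr//.
    rewrite mulN1r mulNr -normrN opprD opprK.
    rewrite -ltNge in sgn.
    by rewrite (le_trans hN')// (le_trans _ (ler_norm _))// lerDr oppr_ge0 ltW.
  have := hC (n k); rewrite !ler_norml.
  move: (\int[mu]_x (f (n k) x * g x)) => I1.
  move: (\int[mu]_x (f (n k) x * G k.+1 x)) => I2.
  have : 0 <= a k * N k by rewrite mulr_ge0// ltW.
  case: (ger0P I2); lra.
have C0 : 0 <= C by apply: le_trans (hC 0%N).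
have q0 : 0 < (4 * C + 4)^-1 by rewrite invr_gt0; lra.
have [k hk] := @expr_small R (3 / 4) _ ltac:(lra) ltac:(lra) q0.
have [kN _ _ _ _] := ht k; rewrite -/(N k) in kN.
have := big k.
have q1 : 0 < (3 / 4 : R) ^+ k by rewrite exprn_gt0// divr_gt0.
have e1 : a k * 4 ^+ k = ((3 / 4) ^+ k)^-1.
  by rewrite /a -exprMn -exprVn; congr (_ ^+ _); field.
have e2 : a k * 4 ^+ k <= a k * N k by rewrite ler_wpM2l ?ltW.
have e3 : 4 * C + 4 <= ((3 / 4) ^+ k)^-1.
  by rewrite -[leLHS]invrK lef_pV2 ?posrE.
lra.
Qed.

(** * Transport of integrable functions *)

Lemma ae_impl d (T : measurableType d) (R : realType)
    (mu : {measure set T -> \bar R}) (P Q : T -> Prop) :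
  (forall x, P x -> Q x) -> {ae mu, forall x, P x} -> {ae mu, forall x, Q x}.
Proof. by move=> PQ; apply: filterS. Qed.

Lemma ae_impl2 d (T : measurableType d) (R : realType)
    (mu : {measure set T -> \bar R}) (P Q S : T -> Prop) :
  (forall x, P x -> Q x -> S x) -> {ae mu, forall x, P x} -> {ae mu, forall x, Q x} ->
  {ae mu, forall x, S x}.
Proof. by move=> PQ; apply: filterS2. Qed.

Lemma integral_indicT d (T : measurableType d) (R : realType)
    (mu : {measure set T -> \bar R}) (A : set T) :
  measurable A -> (\int[mu]_x (\1_A x)%:E = mu A)%E.
Proof. by move=> mA; rewrite integral_indic// setIT. Qed.

Lemma measure_preserving_preimage d (T : measurableType d) (R : realType)
    (mu : {measure set T -> \bar R}) (F : T -> T) A :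
  measure_preserving mu F -> measurable A -> measurable (F @^-1` A).
Proof. by move=> [mF _] mA; rewrite -[X in measurable X]setTI; exact: mF. Qed.

Lemma measure_preserving_ge0_integral d (T : measurableType d) (R : realType)
    (mu : {measure set T -> \bar R}) (F : T -> T) (f : T -> \bar R) :
  measure_preserving mu F -> measurable_fun setT f -> (forall x, 0 <= f x)%E ->
  (\int[mu]_x f (F x) = \int[mu]_x f x)%E.
Proof.
move=> [mF hF] mf f0.
have := ge0_integral_pushforward mF mu measurableT mf (fun y _ => f0 y).
rewrite preimage_setT => <-.
by apply: eq_measure_integral => A mA _; exact: hF.
Qed.

Lemma measure_preserving_integral d (T : measurableType d) (R : realType)
    (mu : {measure set T -> \bar R}) (F : T -> T) (f : T -> \bar R) :
  measure_preserving mu F -> measurable_fun setT f ->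
  (\int[mu]_x f (F x) = \int[mu]_x f x)%E.
Proof.
move=> hF mf; have hp : (\int[mu]_x f^\+ (F x) = \int[mu]_x f^\+ x)%E.
  by apply: measure_preserving_ge0_integral => //; exact: measurable_funepos.
have hn : (\int[mu]_x f^\- (F x) = \int[mu]_x f^\- x)%E.
  by apply: measure_preserving_ge0_integral => //; exact: measurable_funeneg.
rewrite integralE [RHS]integralE -hp -hn.
by congr (_ - _)%E; apply: eq_integral => x _; rewrite (funeposE, funenegE) (funeposE, funenegE).
Qed.

Lemma measure_preserving_Rintegral d (T : measurableType d) (R : realType)
    (mu : {measure set T -> \bar R}) (F : T -> T) (f : T -> R) :
  measure_preserving mu F -> measurable_fun setT f ->
  \int[mu]_x f (F x) = \int[mu]_x f x.
Proof.
move=> hF mf; rewrite /Rintegral (measure_preserving_integral (f := EFin \o f) hF)//.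
exact/measurable_EFinP.
Qed.

Lemma measure_preserving_integrable d (T : measurableType d) (R : realType)
    (mu : {measure set T -> \bar R}) (F : T -> T) (g : T -> R) :
  measure_preserving mu F -> mu.-integrable setT (EFin \o g) ->
  mu.-integrable setT (EFin \o (g \o F)).
Proof.
move=> hF /integrableP[mg gfin]; apply/integrableP; split.
  by apply: (measurableT_comp mg); case: hF.
rewrite (measure_preserving_ge0_integral hF (f := fun x => `|(g x)%:E|%E))//.
exact: measurableT_comp.
Qed.

Lemma measure_preserving_ae d (T : measurableType d) (R : realType)
    (mu : {measure set T -> \bar R}) (F : T -> T) (P : T -> Prop) :
  measure_preserving mu F -> {ae mu, forall x, P x} -> {ae mu, forall x, P (F x)}.
Proof.
move=> hF [A [mA A0 PA]]; exists (F @^-1` A); split.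
- exact: measure_preserving_preimage hF mA.
- by rewrite hF.2.
- by move=> x /= hx; apply: PA.
Qed.

(* By measure preservation the reverse difference has the same measure. *)
Definition set_cvg d (T : measurableType d) (R : realType)
    (mu : {measure set T -> \bar R}) (F : nat -> T -> T) (G : T -> T) (E : set T) : Prop :=
  forall e : R, 0 < e ->
    \forall n \near \oo, (mu (G @^-1` E `\` F n @^-1` E) <= e%:E)%E.

Lemma measure_preserving_setD d (T : measurableType d) (R : realType)
    (mu : {measure set T -> \bar R}) (F G : T -> T) (E : set T) :
  measure_preserving mu F -> measure_preserving mu G -> measurable E ->
  (mu E < +oo)%E -> mu (F @^-1` E `\` G @^-1` E) = mu (G @^-1` E `\` F @^-1` E).
Proof.
move=> hF hG mE Efin.
have mFE := measure_preserving_preimage hF mE.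
have mGE := measure_preserving_preimage hG mE.
have eF : mu (F @^-1` E) = mu E := hF.2 _ mE.
have eG : mu (G @^-1` E) = mu E := hG.2 _ mE.
have fF : (mu (F @^-1` E) < +oo)%E by rewrite eF.
have fG : (mu (G @^-1` E) < +oo)%E by rewrite eG.
rewrite (measureD mFE mGE fF) (measureD mGE mFE fG) setIC.
by congr (_ - _)%E; exact: etrans eF (esym eG).
Qed.

Lemma measure_le_setU d (T : measurableType d) (R : realType)
    (mu : {measure set T -> \bar R}) (A B C : set T) :
  measurable A -> measurable B -> measurable C -> A `<=` B `|` C ->
  (mu A <= mu B + mu C)%E.
Proof.
move=> mA mB mC ABC; apply: le_trans (measureU2 mu mB mC).
by apply: le_measure; rewrite ?inE//; exact: measurableU.
Qed.

Lemma set_cvgU d (T : measurableType d) (R : realType)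
    (mu : {measure set T -> \bar R}) (F : nat -> T -> T) (G : T -> T) (A B : set T) :
  (forall n, measure_preserving mu (F n)) -> measure_preserving mu G ->
  measurable A -> measurable B ->
  set_cvg mu F G A -> set_cvg mu F G B -> set_cvg mu F G (A `|` B).
Proof.
move=> hF hG mA mB cA cB e e0.
have e2 : 0 < e / 2 by rewrite divr_gt0.
apply: filterS2 (cA _ e2) (cB _ e2) => n h1 h2.
have mFA := measure_preserving_preimage (hF n) mA.
have mGA := measure_preserving_preimage hG mA.
have mFB := measure_preserving_preimage (hF n) mB.
have mGB := measure_preserving_preimage hG mB.
rewrite (splitr e) EFinD; apply: le_trans (leeD h1 h2).
apply: measure_le_setU; [|exact: measurableD..|].
  by apply: measurableD; exact: measurableU.
move=> x [[xA|xB] /not_orP[h3 h4]]; [by left|by right].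
Qed.

(** If [G x] lies in [A] outside [B] and [F n x] does not, then [F n x] has left [A] or entered [B].
    The second case is the reverse difference for [B], whose measure is known because that of [B] is
    finite. *)
Lemma set_cvgD d (T : measurableType d) (R : realType)
    (mu : {measure set T -> \bar R}) (F : nat -> T -> T) (G : T -> T) (A B : set T) :
  (forall n, measure_preserving mu (F n)) -> measure_preserving mu G ->
  measurable A -> measurable B -> (mu B < +oo)%E ->
  set_cvg mu F G A -> set_cvg mu F G B -> set_cvg mu F G (A `\` B).
Proof.
move=> hF hG mA mB Bfin cA cB e e0.
have e2 : 0 < e / 2 by rewrite divr_gt0.
apply: filterS2 (cA _ e2) (cB _ e2) => n h1 h2.
have mFA := measure_preserving_preimage (hF n) mA.
have mGA := measure_preserving_preimage hG mA.
have mFB := measure_preserving_preimage (hF n) mB.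
have mGB := measure_preserving_preimage hG mB.
rewrite -(measure_preserving_setD (hF n) hG mB Bfin) in h2.
rewrite (splitr e) EFinD; apply: le_trans (leeD h1 h2).
apply: measure_le_setU; [|exact: measurableD..|].
  by apply: measurableD; exact: measurableD.
move=> x [[xA xB] h]; have [xFA|xFA] := pselect ((F n @^-1` A) x); last by left.
by right; split => //; apply: contrapT => xFB; apply: h.
Qed.

(** As [G] preserves measure, the part of [B] outside [A m] costs the same small amount for every
    [n]. *)
Lemma set_cvg_exhaust d (T : measurableType d) (R : realType)
    (mu : {measure set T -> \bar R}) (F : nat -> T -> T) (G : T -> T)
    (A : nat -> set T) (B : set T) :
  (forall n, measure_preserving mu (F n)) -> measure_preserving mu G ->
  (forall m, measurable (A m)) -> measurable B -> (mu B < +oo)%E ->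
  nondecreasing_seq A -> \bigcup_m A m = B ->
  (forall m, set_cvg mu F G (A m)) -> set_cvg mu F G B.
Proof.
move=> hF hG mA mB Bfin ndA AB cA e e0.
have e2 : 0 < e / 2 by rewrite divr_gt0.
have AsB m : A m `<=` B by rewrite -AB; exact: bigcup_sup.
have Afin m : (mu (A m) < +oo)%E.
  by apply: le_lt_trans Bfin; apply: le_measure; rewrite ?inE.
have [m hm] : exists m, (mu (B `\` A m) <= (e / 2)%:E)%E.
  have cv := nondecreasing_cvg_mu mA (bigcupT_measurable _ mA) ndA.
  rewrite AB in cv.
  have Bf : mu B \is a fin_num by rewrite ge0_fin_numE.
  have : (fun m => fine (mu (A m))) @ \oo --> fine (mu B).
    by apply: fine_cvg; rewrite fineK//; exact: cv.
  move=> /cvgrPdist_le /(_ _ e2)[m _ /(_ m (leqnn _)) /= hm]; exists m.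
  have -> : mu (B `\` A m) = (mu B - mu (A m))%E by rewrite measureD// setIidr.
  rewrite -(fineK Bf) -(@fineK _ (mu (A m))) ?ge0_fin_numE// -EFinB lee_fin.
  exact: le_trans (ler_norm _) hm.
apply: filterS (cA m _ e2) => n h1.
have mFA := measure_preserving_preimage (hF n) (mA m).
have mGA := measure_preserving_preimage hG (mA m).
have mFB := measure_preserving_preimage (hF n) mB.
have mGB := measure_preserving_preimage hG mB.
have mBA : measurable (B `\` A m) by exact: measurableD.
have mGBA := measure_preserving_preimage hG mBA.
rewrite -(hG.2 _ mBA) in hm.
rewrite (splitr e) EFinD; apply: le_trans (leeD h1 hm).
apply: measure_le_setU; [exact: measurableD..|exact: mGBA|].
move=> x [xB h]; have [xA|xA] := pselect (A m (G x)); last by right.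
by left; split => // xFA; apply: h; exact: (AsB m).
Qed.

(** For almost every [x] the point [G x] is off the boundary of [E], so [F n x] ends up on the same
    side of it. The one-sided difference lies in the preimage of [E] under [G], a fixed set of
    finite measure, which is what dominated convergence needs. *)
Lemma set_cvg_continuity (R : realType) (F : nat -> plane R -> plane R)
    (G : plane R -> plane R) (E : set (plane R)) :
  (forall n, measure_preserving (leb2 R) (F n)) -> measure_preserving (leb2 R) G ->
  (forall x, (fun n => F n x) @ \oo --> G x) ->
  measurable E -> (leb2 R E < +oo)%E ->
  {ae leb2 R, forall y, \forall z \near y, E z <-> E y} ->
  set_cvg (leb2 R) F G E.
Proof.
move=> hF hG FG mE Efin aeE.
have mFE n := measure_preserving_preimage (hF n) mE.
have mGE := measure_preserving_preimage hG mE.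
pose D n := G @^-1` E `\` F n @^-1` E.
have mD n : measurable (D n) := measurableD mGE (mFE n).
have mf n : measurable_fun setT (fun x => (\1_(D n) x)%:E : \bar R).
  by apply/measurable_EFinP; exact: measurable_indic.
have ig : (leb2 R).-integrable setT (fun x => (\1_(G @^-1` E) x : R)%:E).
  apply/integrableP; split; first by apply/measurable_EFinP; exact: measurable_indic.
  under eq_integral do rewrite gee0_abs//.
  have eG : (leb2 R (G @^-1` E) < +oo)%E by rewrite (_ : leb2 R _ = leb2 R E)//; exact: hG.2.
  by rewrite integral_indicT.
have dom : {ae leb2 R, forall x, forall n, setT x ->
    (`|(\1_(D n) x : R)%:E| <= (\1_(G @^-1` E) x : R)%:E)%E}.
  apply: aeW => x n _; rewrite gee0_abs// lee_fin !indicE.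
  have [xD|] := boolP (x \in D n) => //.
  have -> // : x \in G @^-1` E by rewrite inE; move: xD; rewrite inE => -[].
have cv : {ae leb2 R, forall x, setT x ->
    (fun n => (\1_(D n) x)%:E : \bar R) @ \oo --> (cst 0 x : \bar R)}.
  apply: filterS (measure_preserving_ae hG aeE) => x hx _.
  apply: cvg_near_cst; have := FG x _ hx; rewrite nbhs_filterE => -[N _ HN].
  exists N => // n /HN /= h; rewrite indicE.
  rewrite (_ : (x \in D n) = false)//; apply/negP; rewrite inE => -[h1 h2].
  by apply: h2; apply/h.
have [_ _ lim] := @dominated_convergence _ _ _ (leb2 R) setT measurableT _ _ _
  mf (measurable_cst 0%E) cv ig dom.
move=> e e0; rewrite integral0 in lim.
move/fine_cvgP: lim => [cfin /cvgrPdist_le /(_ e e0) cdist].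
apply: filterS2 cfin cdist => n /=.
have -> : (\int[leb2 R]_x (\1_(D n) x)%:E = leb2 R (D n))%E.
  exact: (integral_indicT (leb2 R) (mD n)).
move=> h1; rewrite sub0r normrN => h2.
by rewrite -(fineK h1) lee_fin (le_trans _ h2)// ler_norm.
Qed.

(** The boundary of [E] lies in the level set of [c]. Leaving open whether this level belongs to [E]
    covers closed boxes and open half planes alike. *)
Lemma sublevel_continuity (R : realType) (phi : plane R -> R) (c : R) (E : set (plane R)) :
  (forall x y, `|phi x - phi y| <= `|x - y|) ->
  (forall x, phi x < c -> E x) -> (forall x, E x -> phi x <= c) ->
  {ae leb2 R, forall y, phi y != c} ->
  {ae leb2 R, forall y, \forall z \near y, E z <-> E y}.
Proof.
move=> lip Elt Ele; apply: (ae_impl (mu := leb2 R)) => y yc.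
pose d := `|phi y - c|; have d0 : 0 < d by rewrite normr_gt0 subr_eq0.
apply: filterS (nbhsx_ballx y d d0) => z; rewrite -ball_normE /= => yz.
have zy : `|phi y - phi z| < `|phi y - c| by apply: le_lt_trans yz.
have [yltc|cy] : phi y < c \/ c < phi y by apply/orP; rewrite -neq_lt.
- have zc : phi z < c.
    by move: zy; rewrite (ltr0_norm (x := phi y - c)) ?subr_lt0// ltr_norml => /andP[]; lra.
  by split => _; exact: Elt.
- have zc : c < phi z.
    by move: zy; rewrite (gtr0_norm (x := phi y - c)) ?subr_gt0// ltr_norml => /andP[]; lra.
  by split => /Ele; rewrite leNgt (zc, cy).
Qed.

Lemma ae_coord_neq (R : realType) i (c : R) : {ae leb2 R, forall y, coord i y != c}.
Proof.
have z : lebesgue_measure ([set c] : set R) = 0%E := lebesgue_measure_set1 c.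
case: i.
- exists ([set c] `*` setT); split; first exact: measurableX.
  + by rewrite product_measure1E// [X in (X * _)%E]z mul0e.
  + by move=> x /negP; rewrite negbK => /eqP.
- exists (setT `*` [set c]); split; first exact: measurableX.
  + by rewrite product_measure1E// [X in (_ * X)%E]z mule0.
  + by move=> x /negP; rewrite negbK => /eqP.
Qed.

(** The boundary of a box lies on four lines parallel to the axes. *)
Lemma ae_norm_neq (R : realType) (c : R) : {ae leb2 R, forall y : plane R, `|y| != c}.
Proof.
have h i := ae_coord_neq i c; have h' i := ae_coord_neq i (- c).
have k i := ae_impl2 (mu := leb2 R) (fun _ h1 h2 => conj h1 h2) (h i) (h' i).
apply: (ae_impl2 (mu := leb2 R)) (k true) (k false) => y [/= h1 h2] [/= h3 h4].
apply/eqP => yc.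
have : (`|y| == `|y.1|) || (`|y| == `|y.2|).
  by rewrite plane_normE; case: (leP `|y.1| `|y.2|); rewrite ?eqxx ?orbT.
rewrite yc => /orP[] /eqP ec.
- have [/eqP|/eqP] : y.1 = c \/ y.1 = - c; rewrite ?(negbTE h1) ?(negbTE h2)//.
  by rewrite ec; case: (ger0P y.1) => _; [left|right; rewrite opprK].
- have [/eqP|/eqP] : y.2 = c \/ y.2 = - c; rewrite ?(negbTE h3) ?(negbTE h4)//.
  by rewrite ec; case: (ger0P y.2) => _; [left|right; rewrite opprK].
Qed.

Lemma box_measure_lty (R : realType) (r : R) : 0 <= r -> (leb2 R (box r) < +oo)%E.
Proof.
move=> r0; have := plane_box_measure (0 : plane R) r0.
rewrite (_ : [set p | _] = box r); first by move=> ->; exact: ltry.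
by apply/seteqP; split => p; rewrite /box /= sub0r normrN.
Qed.

Lemma box_continuity (R : realType) (r : R) :
  {ae leb2 R, forall y, \forall z \near y, box r z <-> box r y}.
Proof.
apply: (sublevel_continuity (phi := fun y => `|y|) (c := r)).
- by move=> x y; exact: ler_dist_dist.
- by move=> x /ltW.
- by [].
- exact: ae_norm_neq.
Qed.

Lemma half_plane_continuity (R : realType) i (c : R) :
  {ae leb2 R, forall y, \forall z \near y,
     (coord i @^-1` `]-oo, c[%classic) z <-> (coord i @^-1` `]-oo, c[%classic) y}.
Proof.
apply: (sublevel_continuity (phi := coord i) (c := c)).
- by move=> x y; rewrite -coordB coord_le_norm.
- by move=> x; rewrite /= in_itv.
- by move=> x; rewrite /= in_itv/= => /ltW.
- exact: ae_coord_neq.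
Qed.

Lemma set_cvg0 d (T : measurableType d) (R : realType)
    (mu : {measure set T -> \bar R}) (F : nat -> T -> T) (G : T -> T) :
  set_cvg mu F G set0.
Proof. by move=> e e0; apply: nearW => n; rewrite preimage_set0 set0D measure0 lee_fin ltW. Qed.

(* The sets whose traces on boxes converge form a sigma-algebra, which contains
   the half planes because their boundaries are negligible. *)
Lemma set_cvg_measurable (R : realType) (F : nat -> plane R -> plane R)
    (G : plane R -> plane R) (E : set (plane R)) :
  (forall n, measure_preserving (leb2 R) (F n)) -> measure_preserving (leb2 R) G ->
  (forall x, (fun n => F n x) @ \oo --> G x) ->
  measurable E -> (leb2 R E < +oo)%E -> set_cvg (leb2 R) F G E.
Proof.
move=> hF hG FG mE Efin.
(* Half planes have infinite measure, as do complements of bounded sets, while [set_cvgD] and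
   [set_cvg_continuity] work with finite measure; hence the boxes. *)
pose C : set (set (plane R)) := [set A | measurable A /\
  forall r, 0 <= r -> set_cvg (leb2 R) F G (A `&` box r)].
have fin A r : 0 <= r -> measurable A -> (leb2 R (A `&` box r) < +oo)%E.
  move=> r0 mA; apply: le_lt_trans (box_measure_lty r0).
  apply: le_measure; rewrite ?inE//; last exact: measurable_box.
  by apply: measurableI => //; exact: measurable_box.
have sC : sigma_algebra setT C.
  split.
  - by split => // r r0; rewrite set0I; exact: set_cvg0.
  - move=> A [mA cA]; split; first exact: measurableD.
    move=> r r0; rewrite (_ : _ `&` _ = box r `\` (A `&` box r)); last first.
      apply/seteqP; split => x /= [].
      + by move=> [_ xA] xr; split => // -[].
      + by move=> xr xA; split => //; split => // h; apply: xA.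
    apply: (set_cvgD hF hG (measurable_box r) _ (fin A r r0 mA) _ (cA r r0)).
      by apply: measurableI => //; exact: measurable_box.
    apply: set_cvg_continuity (box_continuity r) => //; first exact: measurable_box.
    exact: box_measure_lty.
  - move=> A hA.
    have mA k : measurable (A k) by case: (hA k).
    split; first exact: bigcupT_measurable.
    move=> r r0.
    pose B m := \bigcup_(k in [set k | (k < m)%N]) A k `&` box r.
    have mB m : measurable (B m).
      apply: measurableI; last exact: measurable_box.
      by apply: bigcup_measurable => k _.
    apply: (@set_cvg_exhaust _ _ _ (leb2 R) F G B) => //.
    + apply: measurableI; last exact: measurable_box.
      exact: bigcupT_measurable.
    + by apply: fin => //; exact: bigcupT_measurable.
    + apply/nondecreasing_seqP => m; apply/subsetPset => x [[k /= km Akx] xr].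
      by split => //; exists k => //=; rewrite ltnS ltnW.
    + apply/seteqP; split => x.
        by move=> [m _ [[k _ Akx] xr]]; split => //; exists k.
      by move=> [[k _ Akx] xr]; exists k.+1 => //; split => //; exists k => /=.
    + elim=> [|m IH].
        rewrite (_ : B 0%N = set0); first exact: set_cvg0.
        by apply/seteqP; split => // x [[]].
      rewrite (_ : B m.+1 = B m `|` (A m `&` box r)).
        have mAr : measurable (A m `&` box r).
          by apply: measurableI; [exact: mA|exact: measurable_box].
        by apply: (set_cvgU hF hG (mB m) mAr IH); case: (hA m) => _ cA; exact: cA.
      apply/seteqP; split => x.
        move=> [[k /= + Akx] xr]; rewrite ltnS leq_eqVlt => /orP[/eqP km|km].
          by right; split => //; rewrite -km.
        by left; split => //; exists k.
      move=> [[[k /= km Akx] xr]|[Amx xr]]; split => //.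
        by exists k => //=; rewrite ltnS ltnW.
      by exists m => /=.
have half i (c : R) : C (coord i @^-1` `]-oo, c[%classic).
  have mH : measurable (coord i @^-1` (`]-oo, c[%classic : set R)).
    by rewrite -[X in measurable X]setTI; apply: measurable_coord.
  split => // r r0; apply: set_cvg_continuity => //.
  - by apply: measurableI => //; exact: measurable_box.
  - exact: fin.
  - apply: (ae_impl2 (mu := leb2 R)) (half_plane_continuity i c) (box_continuity r).
    move=> y h1 h2; apply: filterS2 h1 h2 => z [h1 h1'] [h2 h2'].
    by split => -[]; split; auto.
have coordC i (B : set R) : measurable B -> C (coord i @^-1` B).
  pose CB : set (set R) := [set B | C (coord i @^-1` B)].
  have sCB : sigma_algebra setT CB.
    have [C0 CD CU] := sC; split.
    - by rewrite /CB /= preimage_set0.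
    - by move=> A /CD; rewrite /CB /= !setTD.
    - by move=> A hA; rewrite /CB /= preimage_bigcup; exact: CU.
  move: B; change (measurable `<=` CB).
  rewrite [X in X `<=` _](RGenInftyO.measurableE R).
  apply: smallest_sub => // _ [c ->]; exact: half.
have allC : measurable `<=` C.
  apply: smallest_sub => //; rewrite subUset; split => _ [B mB <-]; rewrite setTI.
  - exact: (coordC true).
  - exact: (coordC false).
pose B m := E `&` box m%:R.
have [_ cE] := allC _ mE.
apply: (@set_cvg_exhaust _ _ _ (leb2 R) F G B) => //.
- by move=> m; apply: measurableI => //; exact: measurable_box.
- apply/nondecreasing_seqP => m; apply/subsetPset => x [xE]; rewrite /box /= => xm.
  by split => //; apply: (le_trans xm); rewrite ler_nat.
- apply/seteqP; split => x; first by move=> [m _ []].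
  move=> xE; exists (Num.truncn `|x|).+1 => //; split => //.
  exact: ltW (truncnS_gt _).
- by move=> m; exact: cE.
Qed.

Definition transport_cvg d (T : measurableType d) (R : realType)
    (mu : {measure set T -> \bar R}) (F : nat -> T -> T) (G : T -> T) (g : T -> R) : Prop :=
  forall e : R, 0 < e ->
    \forall n \near \oo, (\int[mu]_x `|g (F n x) - g (G x)|%:E <= e%:E)%E.

Lemma transport_cvg_indic d (T : measurableType d) (R : realType)
    (mu : {measure set T -> \bar R}) (F : nat -> T -> T) (G : T -> T) (E : set T) :
  (forall n, measure_preserving mu (F n)) -> measure_preserving mu G ->
  measurable E -> (mu E < +oo)%E -> set_cvg mu F G E ->
  transport_cvg mu F G (\1_E : T -> R).
Proof.
move=> hF hG mE Efin cE e e0.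
have e2 : 0 < e / 2 by rewrite divr_gt0.
apply: filterS (cE _ e2) => n h.
have mFE := measure_preserving_preimage (hF n) mE.
have mGE := measure_preserving_preimage hG mE.
have mA : measurable (G @^-1` E `\` F n @^-1` E) by exact: measurableD.
have mB : measurable (F n @^-1` E `\` G @^-1` E) by exact: measurableD.
have h' : (mu (F n @^-1` E `\` G @^-1` E) <= (e / 2)%:E)%E.
  by rewrite (measure_preserving_setD (hF n) hG mE Efin).
rewrite (splitr e) EFinD; apply: le_trans (leeD h h').
rewrite -(integral_indicT mu mA) -(integral_indicT mu mB) -ge0_integralD//; last 2 first.
- by apply/measurable_EFinP; exact: measurable_indic.
- by apply/measurable_EFinP; exact: measurable_indic.
apply: ge0_le_integral => //.
- apply/measurable_EFinP; apply: measurableT_comp => //; apply: measurable_funB.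
  + by apply: measurableT_comp; [exact: measurable_indic|case: (hF n)].
  + by apply: measurableT_comp; [exact: measurable_indic|case: hG].
- by apply: emeasurable_funD; apply/measurable_EFinP; exact: measurable_indic.
- move=> x _; rewrite -EFinD lee_fin !indicE !in_setD.
  rewrite (_ : (x \in G @^-1` E) = (G x \in E));
    last by apply/idP/idP => /set_mem xE; exact: mem_set.
  rewrite (_ : (x \in F n @^-1` E) = (F n x \in E));
    last by apply/idP/idP => /set_mem xE; exact: mem_set.
  by case: (F n x \in E); case: (G x \in E) => /=;
    rewrite ?subrr ?subr0 ?sub0r ?normrN ?normr1 ?normr0 ?addr0 ?add0r.
Qed.

Lemma transport_cvgD d (T : measurableType d) (R : realType)
    (mu : {measure set T -> \bar R}) (F : nat -> T -> T) (G : T -> T) (f g : T -> R) :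
  (forall n, measure_preserving mu (F n)) -> measure_preserving mu G ->
  measurable_fun setT f -> measurable_fun setT g ->
  transport_cvg mu F G f -> transport_cvg mu F G g ->
  transport_cvg mu F G (fun x => f x + g x).
Proof.
move=> hF hG mf mg cf cg e e0.
have e2 : 0 < e / 2 by rewrite divr_gt0.
have mc (h : T -> R) (P : T -> T) : measurable_fun setT h -> measure_preserving mu P ->
    measurable_fun setT (fun x => h (P x)).
  by move=> mh [mP _]; exact: measurableT_comp.
apply: filterS2 (cf _ e2) (cg _ e2) => n h1 h2.
rewrite (splitr e).
under eq_integral => x _ do rewrite opprD addrACA.
apply: integrable_norm_leD => //; apply: measurable_funB; exact: mc.
Qed.

Lemma transport_cvgZ d (T : measurableType d) (R : realType)
    (mu : {measure set T -> \bar R}) (F : nat -> T -> T) (G : T -> T) (g : T -> R) (c : R) :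
  (forall n, measure_preserving mu (F n)) -> measure_preserving mu G ->
  measurable_fun setT g -> transport_cvg mu F G g ->
  transport_cvg mu F G (fun x => c * g x).
Proof.
move=> hF hG mg cg e e0.
have c1 : 0 < `|c| + 1 by rewrite ltr_wpDl.
have mc (P : T -> T) : measure_preserving mu P -> measurable_fun setT (fun x => g (P x)).
  by move=> [mP _]; exact: measurableT_comp.
apply: filterS (cg _ (divr_gt0 e0 c1)) => n h.
under eq_integral => x _ do rewrite -mulrBr normrM EFinM.
rewrite ge0_integralZl_EFin//; last first.
  by apply/measurable_EFinP; apply: measurableT_comp => //; apply: measurable_funB; exact: mc.
apply: (le_trans (lee_wpmul2l _ h)); first by rewrite lee_fin.
by rewrite -EFinM lee_fin mulrA ler_pdivrMr// mulrC ler_wpM2l ?lerDl// ltW.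
Qed.

Import HBSimple.

(** Simple functions are dense in L1, and by measure preservation replacing [g] by one of them costs
    the same [e / 4] under [G] and under every [F n]. *)
Lemma transport_cvg_integrable d (T : measurableType d) (R : realType)
    (mu : {measure set T -> \bar R}) (F : nat -> T -> T) (G : T -> T) (g : T -> R) :
  (forall n, measure_preserving mu (F n)) -> measure_preserving mu G ->
  (forall E, measurable E -> (mu E < +oo)%E -> set_cvg mu F G E) ->
  mu.-integrable setT (EFin \o g) -> transport_cvg mu F G g.
Proof.
move=> hF hG cE ig.
have mg : measurable_fun setT g by apply/measurable_EFinP; exact: measurable_int ig.
have simple (s : {sfun T >-> R}) : mu.-integrable setT (EFin \o s) -> transport_cvg mu F G s.
  move=> is_; rewrite (_ : (s : T -> R) = fun x =>
      \sum_(y <- fset_set (range s)) y * \1_(s @^-1` [set y]) x); last first.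
    apply/funext => x; rewrite fimfunE fsbig_finite//=.
  elim: (fset_set (range s) : seq R) => [|y r IH].
    move=> e e0; apply: nearW => n; under eq_integral do rewrite !big_nil subrr normr0.
    by rewrite integral0 lee_fin ltW.
  rewrite (_ : (fun x => \sum_(z <- y :: r) _) =
      fun x => y * \1_(s @^-1` [set y]) x + \sum_(z <- r) z * \1_(s @^-1` [set z]) x);
    last by apply/funext => x; rewrite big_cons.
  have mS z : measurable (s @^-1` [set z]) by [].
  have m1 z : measurable_fun setT (\1_(s @^-1` [set z]) : T -> R) by exact: measurable_indic.
  apply: transport_cvgD => //.
  - exact: measurable_funM.
  - by apply: measurable_sum => z; exact: measurable_funM.
  (* The fibre over 0 may have infinite measure, but its coefficient vanishes; the other fibres have
     finite measure because [s] is integrable. *)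
  have [->|y0] := eqVneq y 0.
    move=> e e0; apply: nearW => n; under eq_integral do rewrite !mul0r subrr normr0.
    by rewrite integral0 lee_fin ltW.
  apply: transport_cvgZ => //.
  have Sfin : (mu (s @^-1` [set y]) < +oo)%E.
    have [c sc] := integrable_norm_lty is_.
    have : (`|y|%:E * mu (s @^-1` [set y]) <= c%:E)%E.
      rewrite -sc -(integral_indicT mu (mS y)) -ge0_integralZl_EFin//; last first.
        exact/measurable_EFinP.
      apply: ge0_le_integral => //.
      - by apply: measurable_funeM; exact/measurable_EFinP.
      - by apply/measurable_EFinP; exact: measurableT_comp.
      - move=> x _; rewrite -EFinM lee_fin indicE.
        have [xS|_] := boolP (x \in s @^-1` [set y]); last by rewrite mulr0.
        by have /= -> := set_mem xS; rewrite mulr1.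
    by rewrite ltey; apply: contraTneq => ->; rewrite mulry gtr0_sg ?normr_gt0// mul1e -ltNge ltry.
  apply: transport_cvg_indic => //; exact: cE.
have mFg P : measure_preserving mu P -> forall h : T -> R, measurable_fun setT h ->
    measurable_fun setT (fun x => h (P x)).
  by move=> [mP _] h mh; exact: measurableT_comp.
have [s [is_ _ sg]] := approximation_sfun_integrable measurableT ig.
move=> e e0; have e4 : 0 < e / 4 by rewrite divr_gt0.
move/fine_cvgP: sg => [sfin /cvgrPdist_le /(_ _ e4) sdist].
have [m _ Hm] := filterI sfin sdist.
have [/= h1] := Hm m (leqnn _); rewrite sub0r normrN => h2.
have gs : (\int[mu]_x `|g x - s m x|%:E <= (e / 4)%:E)%E.
  rewrite (_ : (\int[mu]_x _)%E = (\int[mu]_x `|(EFin \o g) x - (s m x)%:E|)%E); last first.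
    exact: eq_integral.
  by rewrite -(fineK h1) lee_fin (le_trans _ h2)// ler_norm.
have msm : measurable_fun setT (s m) by [].
have gsP P : measure_preserving mu P -> (\int[mu]_x `|g (P x) - s m (P x)|%:E <= (e / 4)%:E)%E.
  move=> hP; rewrite (measure_preserving_ge0_integral hP (f := fun x => `|g x - s m x|%:E))//.
  by apply/measurable_EFinP; apply: measurableT_comp => //; exact: measurable_funB.
have e2 : 0 < e / 2 by rewrite divr_gt0.
apply: filterS (simple (s m) (is_ m) _ e2) => n h.
have gsG : (\int[mu]_x `|s m (G x) - g (G x)|%:E <= (e / 4)%:E)%E.
  by under eq_integral do rewrite distrC; exact: gsP.
have mB P Q (a b : T -> R) : measure_preserving mu P -> measure_preserving mu Q ->
    measurable_fun setT a -> measurable_fun setT b ->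
    measurable_fun setT (fun x => a (P x) - b (Q x)).
  by move=> hP hQ ma mb; apply: measurable_funB; exact: mFg.
have := integrable_norm_leD (measurable_funD (mB _ _ _ _ (hF n) (hF n) mg msm)
   (mB _ _ _ _ (hF n) hG msm msm)) (mB _ _ _ _ hG hG msm mg)
   (integrable_norm_leD (mB _ _ _ _ (hF n) (hF n) mg msm)
   (mB _ _ _ _ (hF n) hG msm msm) (gsP _ (hF n)) h) gsG.
have sumE x : (g (F n x) - s m (F n x)) + (s m (F n x) - s m (G x)) + (s m (G x) - g (G x)) =
    g (F n x) - g (G x) by rewrite [X in X + _]addrA subrK addrA subrK.
under eq_integral => x _ do rewrite sumE.
by rewrite (_ : e / 4 + e / 2 + e / 4 = e)//; field.
Qed.

(** * Yudovich solutions *)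

Lemma Linfty_c_measurable (R : realType) (w : plane R -> R) :
  Linfty_c w -> measurable_fun setT w.
Proof. by move=> [+ _]; rewrite inE => /andP[]; rewrite inE. Qed.

Lemma Linfty_c_ess_bounded (R : realType) (w : plane R -> R) :
  Linfty_c w -> exists B : R, 0 <= B /\ {ae leb2 R, forall x, `|w x| <= B}.
Proof.
move=> [+ _]; rewrite inE => /andP[_]; rewrite inE /= /finite_norm unlock /Lnorm.
(* The norm is defined as 0 when the whole space is null; in that case every property holds almost
   everywhere. *)
case: ifPn => [mu0|mu0 _]; last first.
  exists 0; split => //; exists setT; split => //.
  by apply/eqP; rewrite eq_le measure_ge0 andbT leNgt.
set s := ess_sup _ _ => slt.
exists (Num.max 0 (fine s)); split; first by rewrite le_max lexx.
apply: (ae_impl (mu := leb2 R)) (ess_sup_ge (leb2 R) (fun x => `|(w x)%:E|%E)).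
move=> x /= hx.
have sf : s \is a fin_num.
  rewrite fin_numElt slt andbT; apply: lt_le_trans hx; exact: ltNyr.
by rewrite -lee_fin (le_trans hx)// -/s -(fineK sf) lee_fin le_max lexx orbT.
Qed.

Lemma Linfty_c_integrable (R : realType) (w : plane R -> R) :
  Linfty_c w -> (leb2 R).-integrable setT (EFin \o w).
Proof.
move=> hw; have mw := Linfty_c_measurable hw.
have [B [B0 wB]] := Linfty_c_ess_bounded hw.
have [_ [C cC wC]] := hw.
have [r [r0 Cr]] : exists r : R, 0 <= r /\ C `<=` box r.
  have [M [_ hM]] := compact_bounded cC.
  exists (Num.max 0 (M + 1)); split; first by rewrite le_max lexx.
  by move=> x Cx; rewrite /box /=; apply: hM Cx; rewrite lt_max ltrDl ltr01 orbT.
have mk : measurable_fun setT (fun x => B * \1_(box r) x : R).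
  by apply: measurable_funM => //; apply: measurable_indic; exact: measurable_box.
apply/integrableP; split; first exact/measurable_EFinP.
apply: (@le_lt_trans _ _ (\int[leb2 R]_x (B * \1_(box r) x)%:E)%E).
  apply: ae_ge0_le_integral => //.
  - by apply/measurable_EFinP; exact: measurableT_comp.
  - by move=> x _; rewrite lee_fin mulr_ge0.
  - exact/measurable_EFinP.
  - apply: (ae_impl2 (mu := leb2 R)) wB wC => x xB xC _; rewrite lee_fin indic_box.
    have [xr|xr] := boolP (`|x| <= r); first by rewrite mulr1.
    by rewrite xC ?normr0 ?mulr0// => /Cr xr'; move/negP: xr; apply.
under eq_integral do rewrite EFinM.
rewrite ge0_integralZl_EFin//; last first.
  by apply/measurable_EFinP; apply: measurable_indic; exact: measurable_box.
rewrite (integral_indicT (leb2 R) (measurable_box r)).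
by rewrite lte_mul_pinfty// box_measure_lty.
Qed.

(** Truncation turns a bound almost everywhere into the bound at every point that [density] asks
    for, without increasing the L1 norm. *)
Definition clip (R : realType) (A : R) T (w : T -> R) (x : T) : R :=
  Num.max (- A) (Num.min A (w x)).

Lemma clip_id (R : realType) (A : R) T (w : T -> R) x :
  `|w x| <= A -> clip A w x = w x.
Proof.
by rewrite ler_norml => /andP[h1 h2]; rewrite /clip min_r// max_r.
Qed.

Lemma clip_le (R : realType) (A : R) T (w : T -> R) x : 0 <= A -> `|clip A w x| <= A.
Proof.
move=> A0; rewrite ler_norml /clip le_max lexx/= ge_max ge_min lexx/= andbT.
by rewrite (le_trans _ A0)// oppr_le0.
Qed.

Lemma clip_norm_le (R : realType) (A : R) T (w : T -> R) x : 0 <= A ->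
  `|clip A w x| <= `|w x|.
Proof.
move=> A0; rewrite /clip; case: (leP A (w x)) => h1.
  by rewrite max_r ?ger0_norm// ?(le_trans A0)// (le_trans _ A0)// oppr_le0.
case: (leP (- A) (w x)) => h2 //.
have h3 : A <= - w x by rewrite lerNr ltW.
by rewrite normrN (ger0_norm A0) (le_trans h3)// -normrN ler_norm.
Qed.

Lemma measurable_clip d (T : measurableType d) (R : realType) (A : R) (w : T -> R) :
  measurable_fun setT w -> measurable_fun setT (clip A w).
Proof. by move=> mw; apply: measurable_maxr => //; exact: measurable_minr. Qed.

Lemma Rintegral_ae_eq d (T : measurableType d) (R : realType)
    (mu : {measure set T -> \bar R}) (f g : T -> R) :
  measurable_fun setT f -> measurable_fun setT g -> {ae mu, forall x, f x = g x} ->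
  \int[mu]_x f x = \int[mu]_x g x.
Proof.
move=> mf mg fg; rewrite /Rintegral; congr fine; apply: ae_eq_integral => //.
- exact/measurable_EFinP.
- exact/measurable_EFinP.
- by apply: filterS fg => x /= -> _.
Qed.

Lemma is_derive_coord (R : realType) i (f : R -> plane R) (t : R) (v : plane R) :
  is_derive t (1 : R) f v -> is_derive t (1 : R) (fun s => coord i (f s)) (coord i v).
Proof.
move=> [df <-].
have cq := df : cvg _.
have cc : {for ('D_1 f t), continuous (@coord R i)}.
  by case: i => //=; [exact: cvg_fst|exact: cvg_snd].
have := continuous_cvg _ cc cq => cv.
have q : (fun h => h^-1 *: (((fun s => coord i (f s)) \o shift t) (h *: (1 : R)) -
    coord i (f t))) @ 0^' --> coord i ('D_1 f t).
  rewrite (_ : (fun h => _) =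
    (fun h => coord i (h^-1 *: ((f \o shift t) (h *: (1 : R)) - f t)))); first exact: cv.
  by apply/funext => h /=; case: i {cc cv}.
split; [by apply/cvg_ex; exists (coord i ('D_1 f t)); exact: q|].
by rewrite /derive; apply: cvg_lim => //; exact: q.
Qed.

(** Change of variables along [X t]. The relation [w t x = w0 (Y x)] is taken at [x = X t y], where
    it reads [w t (X t y) = w0 y], so that null sets are only pulled back by [X t]. *)
Lemma yudovich_velocityE (R : realType) (w0 v : plane R -> R) (A M : R)
    (w : R -> plane R -> R) (u X : R -> plane R -> plane R) i t z :
  yudovich_solution w0 w u X -> density (leb2 R) A M v ->
  {ae leb2 R, forall x, w0 x = v x} -> coord i (u t z) = velocity i (X t) v z.
Proof.
move=> sol [mv _ _] wv.
have mX := yudovich_measure_preserving sol t.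
have mw : measurable_fun setT (w t) := Linfty_c_measurable (yudovich_Linfty_c sol t).
have mK : measurable_fun setT (fun y : plane R => kernel i (z - y) * w t y).
  by apply: (@measurable_kernelM _ _ R i (fun y : plane R => z - y)) => //;
    exact: (@measurable_sub_fun _ _ R z id).
rewrite (yudovich_velocity sol).
rewrite (_ : coord i _ = \int[leb2 R]_y (kernel i (z - y) * w t y)); last by case: i {mK}.
rewrite -(@measure_preserving_Rintegral _ _ R (leb2 R) _ _ mX mK).
have [Y [XY YX wY]] := yudovich_transport sol t.
apply: Rintegral_ae_eq.
- by apply: (measurableT_comp mK); case: mX.
- by apply: measurable_kernelM => //; apply: measurable_sub_fun; case: mX.
- apply: (ae_impl2 (mu := leb2 R)) (measure_preserving_ae mX wY) wv => y /= wXy wvy.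
  by rewrite wXy XY wvy.
Qed.

Lemma yudovich_lagrangian (R : realType) (w0 v : plane R -> R) (A M : R)
    (w : R -> plane R -> R) (u X : R -> plane R -> plane R) :
  yudovich_solution w0 w u X -> density (leb2 R) A M v ->
  {ae leb2 R, forall x, w0 x = v x} -> lagrangian_flow 1 v X.
Proof.
move=> sol hv wv; split.
- exact: yudovich_measure_preserving sol.
- exact: yudovich_init sol.
- move=> i s x; rewrite mul1r -(yudovich_velocityE i s _ sol hv wv).
  exact: is_derive_coord (yudovich_flow sol s x).
Qed.

Lemma lagrangian_flow_rev (R : realType) (v : plane R -> R) (X : R -> plane R -> plane R) :
  lagrangian_flow 1 v X -> lagrangian_flow (-1) v (fun s => X (- s)).
Proof.
move=> [mX X0 dX]; split => [s|x|i s x]; [exact: mX|by rewrite oppr0|].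
have h1 : is_derive s (1 : R) (fun s : R => - s) (-1).
  by have := is_deriveN (is_derive_id s (1 : R)).
have h2 := @is_derive1_comp _ (fun s => coord i (X s x)) (fun s => - s) s _ _ (dX i (- s) x) h1.
by apply: is_derive_eq h2 _; rewrite mul1r mulrC.
Qed.

Lemma density_clip d (T : measurableType d) (R : realType)
    (mu : {measure set T -> \bar R}) (A M : R) (w : T -> R) :
  0 <= A -> measurable_fun setT w -> (\int[mu]_x `|w x|%:E <= M%:E)%E ->
  density mu A M (clip A w).
Proof.
move=> A0 mw wM; split; [exact: measurable_clip|by move=> y; exact: clip_le|].
apply: le_trans wM; apply: ge0_le_integral => //.
- by apply/measurable_EFinP; apply: measurableT_comp => //; exact: measurable_clip.
- by apply/measurable_EFinP; exact: measurableT_comp.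
- by move=> x _; rewrite lee_fin clip_norm_le.
Qed.

Lemma yudovich_ae_flow (R : realType) (w0 v : plane R -> R)
    (w : R -> plane R -> R) (u X : R -> plane R -> plane R) t :
  yudovich_solution w0 w u X -> {ae leb2 R, forall x, w0 x = v x} ->
  {ae leb2 R, forall x, w t (X t x) = v x}.
Proof.
move=> sol wv; have mX := yudovich_measure_preserving sol t.
have [Y [XY YX wY]] := yudovich_transport sol t.
apply: (ae_impl2 (mu := leb2 R)) (measure_preserving_ae mX wY) wv => y /= wXy wvy.
by rewrite wXy XY wvy.
Qed.

(** The set where [|w t| > A] has the measure of its preimage under [X t], and on that preimage the
    almost everywhere identity [w t (X t x) = v x] fails. *)
Lemma yudovich_ess_bounded (R : realType) (w0 v : plane R -> R) (A : R)
    (w : R -> plane R -> R) (u X : R -> plane R -> plane R) t :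
  yudovich_solution w0 w u X -> {ae leb2 R, forall x, w0 x = v x} ->
  (forall x, `|v x| <= A) -> {ae leb2 R, forall x, `|w t x| <= A}.
Proof.
move=> sol wv vA; have mX := yudovich_measure_preserving sol t.
have mw : measurable_fun setT (w t) := Linfty_c_measurable (yudovich_Linfty_c sol t).
pose B := (fun x => `|w t x|) @^-1` `]A, +oo[%classic.
have mB : measurable B.
  have : measurable_fun setT (fun x => `|w t x|) by exact: measurableT_comp.
  by move=> h; rewrite -[X in measurable X]setTI; exact: h.
exists B; split => //.
- have eB : leb2 R (X t @^-1` B) = leb2 R B := mX.2 _ mB.
  rewrite -eB.
  have [N [mN N0 hN]] := yudovich_ae_flow t sol wv.
  apply/eqP; rewrite eq_le measure_ge0 andbT -N0.
  apply: le_measure; rewrite ?inE//; first exact: measure_preserving_preimage mX mB.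
  move=> x; rewrite /B /= in_itv/= andbT => hx; apply: hN => /= e.
  by move: hx; rewrite e ltNge vA.
- by move=> x /= /negP; rewrite -ltNge /B /= in_itv/= andbT.
Qed.

Lemma yudovich_flow_cvg (R : realType) (A M : R) (w0 v : plane R -> R)
    (w0n vn : nat -> plane R -> R) (w : R -> plane R -> R)
    (wn : nat -> R -> plane R -> R) (u X : R -> plane R -> plane R)
    (un Xn : nat -> R -> plane R -> plane R) t x :
  0 <= A ->
  yudovich_solution w0 w u X -> (forall n, yudovich_solution (w0n n) (wn n) (un n) (Xn n)) ->
  density (leb2 R) A M v -> (forall n, density (leb2 R) A M (vn n)) ->
  {ae leb2 R, forall x, w0 x = v x} ->
  (forall n, {ae leb2 R, forall x, w0n n x = vn n x}) ->
  weak_star_cvg (leb2 R) [set: plane R] vn v ->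
  (fun n => Xn n t x) @ \oo --> X t x.
Proof.
move=> A0 sol soln hv hvn wv wvn vcvg.
have fX := yudovich_lagrangian sol hv wv.
have fXn n := yudovich_lagrangian (soln n) (hvn n) (wvn n).
have [t0|t0] := leP 0 t.
  have s1 : `|1 : R| <= 1 by rewrite normr1.
  exact: (flow_cvg (x := x) A0 s1 hv hvn fX fXn vcvg t0).
(* Negative times: reversing time gives flows with [sg = -1], evaluated at [- t]. *)
have rX := lagrangian_flow_rev fX.
have rXn n := lagrangian_flow_rev (fXn n).
have nt0 : 0 <= - t by rewrite oppr_ge0 ltW.
have s1 : `|-1 : R| <= 1 by rewrite normrN normr1.
by have := flow_cvg (x := x) A0 s1 hv hvn rX rXn vcvg nt0; rewrite opprK.
Qed.

(** After the change of variables [vn n] is tested against [g o Xn n t]. Replacing this by [g o X t]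
    costs at most [A] times an L1 distance that tends to 0, and then the test function no longer
    depends on [n]. *)
Lemma yudovich_weak_star_cvg (R : realType) (A M : R) (w0 v : plane R -> R)
    (w0n vn : nat -> plane R -> R) (w : R -> plane R -> R)
    (wn : nat -> R -> plane R -> R) (u X : R -> plane R -> plane R)
    (un Xn : nat -> R -> plane R -> plane R) t :
  0 <= A ->
  yudovich_solution w0 w u X -> (forall n, yudovich_solution (w0n n) (wn n) (un n) (Xn n)) ->
  density (leb2 R) A M v -> (forall n, density (leb2 R) A M (vn n)) ->
  {ae leb2 R, forall x, w0 x = v x} ->
  (forall n, {ae leb2 R, forall x, w0n n x = vn n x}) ->
  weak_star_cvg (leb2 R) [set: plane R] vn v ->
  weak_star_cvg (leb2 R) [set: plane R] (fun n => wn n t) (w t).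
Proof.
move=> A0 sol soln hv hvn wv wvn vcvg g ig.
have mg : measurable_fun setT g by apply/measurable_EFinP; exact: measurable_int ig.
have lagr (w0' v' : plane R -> R) w' u' X' : yudovich_solution w0' w' u' X' ->
    density (leb2 R) A M v' -> {ae leb2 R, forall x, w0' x = v' x} ->
    \int[leb2 R]_x (w' t x * g x) = \int[leb2 R]_x (v' x * g (X' t x)).
  move=> sol' [mv' _ _] wv'; have mX' := yudovich_measure_preserving sol' t.
  have mw' : measurable_fun setT (w' t) := Linfty_c_measurable (yudovich_Linfty_c sol' t).
  have mwg : measurable_fun setT (fun x => w' t x * g x) by exact: measurable_funM.
  rewrite -(@measure_preserving_Rintegral _ _ R (leb2 R) _ _ mX' mwg).
  have mgX : measurable_fun setT (fun x => g (X' t x)).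
    by apply: (measurableT_comp mg); case: mX'.
  apply: Rintegral_ae_eq.
  - by apply: (measurableT_comp mwg); case: mX'.
  - exact: measurable_funM.
  - by apply: (ae_impl (mu := leb2 R)) (yudovich_ae_flow t sol' wv') => x ->.
rewrite (lagr _ _ _ _ _ sol hv wv).
under eq_cvg => n do rewrite (lagr _ _ _ _ _ (soln n) (hvn n) (wvn n)).
have mX := yudovich_measure_preserving sol t.
have mXn n := yudovich_measure_preserving (soln n) t.
have Xcvg x := yudovich_flow_cvg (t := t) (x := x) A0 sol soln hv hvn wv wvn vcvg.
have tr : transport_cvg (leb2 R) (fun n => Xn n t) (X t) g.
  by apply: transport_cvg_integrable => // E mE Efin; exact: set_cvg_measurable.
have igX := measure_preserving_integrable mX ig.
have igXn n := measure_preserving_integrable (mXn n) ig.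
have hw := vcvg _ igX.
apply/cvgrPdist_le => e e0.
have A1 : 0 < A + 1 by rewrite ltr_wpDl.
have eA : 0 < e / 2 / (A + 1) by rewrite !divr_gt0.
have e2 : 0 < e / 2 by rewrite divr_gt0.
have /cvgrPdist_le /(_ _ e2) := hw.
apply: filterS2 (tr _ eA) => n h1 h2.
have [mvn vnA _] := hvn n; have [mv vA _] := hv.
have vnae : {ae leb2 R, forall x, `|vn n x| <= A} by exact: aeW.
have idiff : (leb2 R).-integrable setT (EFin \o (fun x => g (Xn n t x) - g (X t x))).
  by have := integrableB measurableT (igXn n) igX.
have bnd := ess_bounded_Rintegral_le mvn A0 vnae idiff h1.
have i1 := ess_bounded_integrable mvn A0 vnae (igXn n).
have i2 := ess_bounded_integrable mvn A0 vnae igX.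
have eqI : \int[leb2 R]_x (vn n x * g (Xn n t x)) =
    \int[leb2 R]_x (vn n x * (g (Xn n t x) - g (X t x))) + \int[leb2 R]_x (vn n x * g (X t x)).
  rewrite -RintegralD//; last exact: ess_bounded_integrable mvn A0 vnae idiff.
  by apply: eq_Rintegral => x _; rewrite mulrBr subrK.
rewrite eqI opprD addrCA addrC (splitr e) (le_trans (ler_normB _ _))// lerD//.
apply: (le_trans bnd).
by rewrite mulrA ler_pdivrMr// mulrC ler_wpM2l ?(ltW e2)// lerDl.
Qed.

(** * From fixed times to space-time *)

(** Fubini reduces the claim to dominated convergence in [t]: almost every slice of [g] is
    integrable, and the inner integrals are bounded by [A] times its L1 norm. *)
Lemma weak_star_cvg_prod d1 d2 (T1 : measurableType d1) (T2 : measurableType d2)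
    (R : realType) (m1 : {sigma_finite_measure set T1 -> \bar R})
    (m2 : {sigma_finite_measure set T2 -> \bar R}) (A : R)
    (fn : nat -> T1 * T2 -> R) (f : T1 * T2 -> R) :
  0 <= A -> (forall n, measurable_fun setT (fn n)) -> measurable_fun setT f ->
  (forall n t, {ae m1, forall x, `|fn n (x, t)| <= A}) ->
  (forall t, {ae m1, forall x, `|f (x, t)| <= A}) ->
  (forall t, weak_star_cvg m1 setT (fun n x => fn n (x, t)) (fun x => f (x, t))) ->
  weak_star_cvg (m1 \x m2)%E setT fn f.
Proof.
move=> A0 mfn mf fnA fA cv g ig.
(* Tonelli: the exceptional set is measurable in the product and each of its slices is null. *)
have aeA (k : T1 * T2 -> R) : measurable_fun setT k ->
    (forall t, {ae m1, forall x, `|k (x, t)| <= A}) ->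
    {ae (m1 \x m2)%E, forall p, `|k p| <= A}.
  move=> mk kA.
  pose N := (fun p => `|k p|) @^-1` `]A, +oo[%classic.
  have mN : measurable N.
    have : measurable_fun setT (fun p => `|k p|) by exact: measurableT_comp.
    by move=> h; rewrite -[X in measurable X]setTI; exact: h.
  exists N; split => //; last first.
    by move=> p /= /negP; rewrite -ltNge /N /= in_itv/= andbT.
  rewrite -(integral_indicT (m1 \x m2)%E mN).
  have mi : measurable_fun setT (EFin \o (\1_N : T1 * T2 -> R)).
    by apply/measurable_EFinP; exact: measurable_indic.
  rewrite (fubini_tonelli2 _ mi); last by move=> p; rewrite lee_fin.
  rewrite -[RHS](integral0 m2 setT); apply: eq_integral => t _.
  rewrite -[RHS](integral0 m1 setT); apply: ae_eq_integral => //.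
  - exact: measurableT_comp mi (measurable_pair2 _).
  - apply: filterS (kA t) => x /= xA _; rewrite indicE.
    rewrite (_ : _ \in _ = false)//; apply/negP => /set_mem.
    by rewrite /N /= in_itv/= andbT ltNge xA.
have mg : measurable_fun setT g by apply/measurable_EFinP; exact: measurable_int ig.
have iM (k : T1 * T2 -> R) : measurable_fun setT k ->
    (forall t, {ae m1, forall x, `|k (x, t)| <= A}) ->
    (m1 \x m2)%E.-integrable setT (EFin \o (fun p => k p * g p)).
  by move=> mk kA; apply: ess_bounded_integrable (aeA k mk kA) ig.
pose I (k : T1 * T2 -> R) t := fubini_G m1 (EFin \o (fun p => k p * g p)) t.
have IE (k : T1 * T2 -> R) : measurable_fun setT k ->
    (forall t, {ae m1, forall x, `|k (x, t)| <= A}) ->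
    \int[(m1 \x m2)%E]_p (k p * g p) = fine (\int[m2]_t I k t)%E.
  by move=> mk kA; rewrite /Rintegral /I (integral21_prod_meas1 (iM k mk kA)).
pose dom t := (A%:E * \int[m1]_x `|g (x, t)|%:E)%E.
have mng : measurable_fun setT (fun p => `|g p|%:E).
  by apply/measurable_EFinP; exact: measurableT_comp.
have mG : measurable_fun setT (fun t => (\int[m1]_x `|g (x, t)|%:E)%E).
  by apply: (measurable_fun_fubini_tonelli_G (m1 := m1) (fun p => `|g p|%:E)).
have idom : m2.-integrable setT dom.
  apply: integrableZl => //; apply/integrableP; split => //.
  have := (integrable21ltyP m1 m2 (measurable_int _ ig)).1 ig.
  apply: le_lt_trans; apply: ge0_le_integral => //.
  - exact: measurableT_comp.
  - by move=> t _; rewrite gee0_abs ?integral_ge0.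
have mslice (k : T1 * T2 -> R) t : measurable_fun setT k ->
    measurable_fun setT (fun x => k (x, t)).
  by move=> mk; exact: measurableT_comp mk (measurable_pair2 _).
have igt : {ae m2, forall t, m1.-integrable setT (fun x => (EFin \o g) (x, t))} :=
  ae_integrable2 ig.
have domI (k : T1 * T2 -> R) t : measurable_fun setT k ->
    (forall t, {ae m1, forall x, `|k (x, t)| <= A}) ->
    (`|I k t| <= dom t)%E.
  move=> mk kA; rewrite /I /fubini_G.
  have mkg : measurable_fun setT (fun x => (k (x, t) * g (x, t))%:E).
    by apply/measurable_EFinP; apply: measurable_funM; exact: mslice.
  apply: (le_trans (le_abse_integral m1 measurableT mkg)).
  rewrite /dom -ge0_integralZl_EFin//; last exact: measurableT_comp mng (measurable_pair2 _).
  apply: ae_ge0_le_integral => //.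
  - exact: measurableT_comp.
  - by move=> x _; rewrite mule_ge0.
  - by apply: measurable_funeM; exact: measurableT_comp mng (measurable_pair2 _).
  - by apply: filterS (kA t) => x xA _; rewrite -EFinM lee_fin normrM ler_wpM2r.
have mI (k : T1 * T2 -> R) : measurable_fun setT k ->
    (forall t, {ae m1, forall x, `|k (x, t)| <= A}) -> measurable_fun setT (I k).
  by move=> mk kA; exact: measurable_fubini_G (iM k mk kA).
have aecv : {ae m2, forall t, setT t -> (fun n => I (fn n) t) @ \oo --> I f t}.
  apply: filterS igt => t igt _.
  have fin (k : T1 * T2 -> R) : measurable_fun setT k ->
      (forall t, {ae m1, forall x, `|k (x, t)| <= A}) ->
      I k t = (\int[m1]_x (k (x, t) * g (x, t)))%:E.
    move=> mk kA; rewrite /Rintegral fineK//.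
    apply: integrable_fin_num => //.
    exact: (ess_bounded_integrable (mslice k t mk) A0 (kA t) igt).
  rewrite fin//; under eq_fun => n do rewrite fin//.
  apply: cvg_EFin; first exact: nearW.
  exact: (cv t (fun x => g (x, t)) igt).
have dom' : {ae m2, forall t, forall n, setT t -> (`|I (fn n) t| <= dom t)%E}.
  by apply: aeW => t n _; exact: domI.
have [If _ lim] := dominated_convergence measurableT (fun n => mI _ (mfn n) (fnA n))
  (mI _ mf fA) aecv idom dom'.
rewrite (IE f mf fA) (_ : (fun n => _) = fun n => fine (\int[m2]_t I (fn n) t)%E); last first.
  by apply/funext => n; rewrite IE.
by apply: fine_cvg; rewrite fineK//; exact: integrable_fin_num If.
Qed.

Lemma leb2_sigma_finite (R : realType) : sigma_finite setT (leb2 R).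
Proof.
exists (fun n => box n%:R) => [|n]; last first.
  by split; [exact: measurable_box|exact: box_measure_lty].
apply/seteqP; split => // x _; exists (Num.truncn `|x|).+1 => //.
exact: ltW (truncnS_gt _).
Qed.

(* leb2 R carries no canonical {sigma_finite_measure set _ -> _} structure. *)
Definition sigma_finite_alias d (T : measurableType d) (R : realType)
    (mu : {measure set T -> \bar R}) (sf : sigma_finite setT mu) : set T -> \bar R := mu.

HB.instance Definition _ d (T : measurableType d) (R : realType)
    (mu : {measure set T -> \bar R}) (sf : sigma_finite setT mu) :=
  Measure.copy (sigma_finite_alias sf) mu.

HB.instance Definition _ d (T : measurableType d) (R : realType)
    (mu : {measure set T -> \bar R}) (sf : sigma_finite setT mu) :=
  Measure_isSigmaFinite.Build d T R (sigma_finite_alias sf) sf.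

Lemma weak_star_cvg_sigma_finite_prod d1 d2 (T1 : measurableType d1)
    (T2 : measurableType d2)
    (R : realType) (m1 : {measure set T1 -> \bar R})
    (m2 : {sigma_finite_measure set T2 -> \bar R}) (A : R)
    (fn : nat -> T1 * T2 -> R) (f : T1 * T2 -> R) :
  sigma_finite setT m1 ->
  0 <= A -> (forall n, measurable_fun setT (fn n)) -> measurable_fun setT f ->
  (forall n t, {ae m1, forall x, `|fn n (x, t)| <= A}) ->
  (forall t, {ae m1, forall x, `|f (x, t)| <= A}) ->
  (forall t, weak_star_cvg m1 setT (fun n x => fn n (x, t)) (fun x => f (x, t))) ->
  weak_star_cvg (m1 \x m2)%E setT fn f.
Proof.
move=> sf A0 mfn mf fnA fA cv g ig.
exact: (@weak_star_cvg_prod _ _ _ _ R (sigma_finite_alias sf) m2 A fn f A0 mfn mf fnA fA cv g ig).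
Qed.

Lemma weak_star_cvg_restrict d (T : measurableType d) (R : realType)
    (mu : {measure set T -> \bar R}) (E : set T) (fn : nat -> T -> R) (f : T -> R) :
  measurable E -> weak_star_cvg mu setT fn f -> weak_star_cvg mu E fn f.
Proof.
move=> mE cv g ig.
have ig' : mu.-integrable setT (EFin \o (g \_ E)).
  by have := (integrable_mkcond (EFin \o g) mE).1 ig; rewrite restrict_EFin.
have restrictM (k : T -> R) : \int[mu]_(x in E) (k x * g x) = \int[mu]_x (k x * (g \_ E) x).
  rewrite Rintegral_mkcond; apply: eq_Rintegral => x _; rewrite !patchE.
  by case: ifP => _; rewrite ?mulr0.
rewrite restrictM (_ : (fun n => _) = fun n => \int[mu]_x (fn n x * (g \_ E) x)).
  exact: cv.
by apply/funext => n; rewrite restrictM.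
Qed.

(** Convergence bounds the integrals for each test function separately, which is all that
    [weakly_bounded_Linfty] asks for. *)
Lemma Linfty_c_uniform_bound (R : realType) (w0n : nat -> plane R -> R) (w0 : plane R -> R) :
  (forall n, Linfty_c (w0n n)) -> weak_star_cvg (leb2 R) [set: plane R] w0n w0 ->
  exists A : R, 0 <= A /\ forall n, {ae leb2 R, forall x, `|w0n n x| <= A}.
Proof.
move=> hwn cv; apply: weakly_bounded_Linfty.
- by move=> n; exact: Linfty_c_integrable.
- by move=> n; have [B [_ hB]] := Linfty_c_ess_bounded (hwn n); exists B.
- move=> g ig; have := cv g ig => /cvgP /cvg_seq_bounded [M [_ hM]].
  by exists (M + 1) => n; apply: hM => //; rewrite ltrDl.
Qed.

Theorem theorem1p5 (R : realType)
    (S : R -> (plane R -> R) -> plane R -> R) (HS : solution_map S)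
    (w0 : plane R -> R) (w0n : nat -> plane R -> R)
    (Hw0 : Linfty_c w0)
    (Hw0n : forall n, Linfty_c (w0n n))
    (Hbound : exists M : R, forall n,
       ('N[leb2 R]_1[EFin \o w0n n] <= M%:E)%E)
    (Hcvg : weak_star_cvg (leb2 R) [set: plane R] w0n w0) :
  (forall T : R, 0 < T ->
     weak_star_cvg (leb2t R) ([set: plane R] `*` `](- T), T[)
       (fun n (p : plane R * R) => S p.2 (w0n n) p.1)
       (fun p : plane R * R => S p.2 w0 p.1)) /\
  (forall t : R,
     weak_star_cvg (leb2 R) [set: plane R]
       (fun n => S t (w0n n)) (S t w0)).
Proof.
have [A1 [A1_ge0 w0nA]] := Linfty_c_uniform_bound Hw0n Hcvg.
have [A2 [A2_ge0 w0A]] := Linfty_c_ess_bounded Hw0.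
have [M1 w0nM] := Hbound.
have [M2 w0M] := integrable_norm_lty (Linfty_c_integrable Hw0).
have M2_ge0 : 0 <= M2 by rewrite -lee_fin -w0M integral_ge0.
(* One pair of constants serves the sequence and the limit. The absolute value makes both summands
   of [M] nonnegative whatever the sign of [M1]. *)
pose A := A1 + A2; pose M := `|M1| + M2.
have A0 : 0 <= A by exact: addr_ge0.
(* The solutions keep [w0] as initial datum; only the Lagrangian description uses [v], which agrees
   with it almost everywhere. *)
pose v := clip A w0; pose vn n := clip A (w0n n).
have wv : {ae leb2 R, forall x, w0 x = v x}.
  apply: (ae_impl (mu := leb2 R)) w0A => x xA.
  by rewrite /v clip_id// (le_trans xA)// lerDr.
have wvn n : {ae leb2 R, forall x, w0n n x = vn n x}.
  apply: (ae_impl (mu := leb2 R)) (w0nA n) => x xA.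
  by rewrite /vn clip_id// (le_trans xA)// lerDl.
have mw0 := Linfty_c_measurable Hw0.
have mw0n n := Linfty_c_measurable (Hw0n n).
have hv : density (leb2 R) A M v.
  by apply: density_clip => //; rewrite w0M lee_fin lerDr.
have hvn n : density (leb2 R) A M (vn n).
  apply: (@density_clip _ _ _ (leb2 R) A M (w0n n) A0 (mw0n n)).
  have := w0nM n; rewrite Lnorm1 => h.
  apply: (@le_trans _ _ M1%:E); first exact: h.
  by rewrite lee_fin (le_trans (ler_norm _))// lerDl.
have vcvg : weak_star_cvg (leb2 R) [set: plane R] vn v.
  move=> g ig.
  have mg : measurable_fun setT g by apply/measurable_EFinP; exact: measurable_int ig.
  have eqw (a b : plane R -> R) : measurable_fun setT a -> measurable_fun setT b ->
      {ae leb2 R, forall x, a x = b x} ->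
      \int[leb2 R]_x (a x * g x) = \int[leb2 R]_x (b x * g x).
    move=> ma mb ab; apply: Rintegral_ae_eq; [exact: measurable_funM..|].
    by apply: (ae_impl (mu := leb2 R)) ab => x ->.
  have [mv _ _] := hv.
  rewrite -(eqw _ _ mw0 mv wv).
  rewrite (_ : (fun n => _) = fun n => \int[leb2 R]_x (w0n n x * g x)); first exact: Hcvg.
  by apply/funext => n; have [mvn _ _] := hvn n; rewrite -(eqw _ _ (mw0n n) mvn (wvn n)).
have [u [X sol]] := HS w0 Hw0.
have [un soln'] := choice (fun n => HS (w0n n) (Hw0n n)).
have [Xn soln] := choice soln'.
have fixed t : weak_star_cvg (leb2 R) [set: plane R] (fun n => S t (w0n n)) (S t w0).
  exact: (yudovich_weak_star_cvg (t := t) A0 sol soln hv hvn wv wvn vcvg).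
split => // T T0; apply: weak_star_cvg_restrict.
  by apply: measurableX.
have [_ vA _] := hv.
have key := @weak_star_cvg_sigma_finite_prod _ _ _ _ R (leb2 R) (@lebesgue_measure R) A
  (fun n (p : plane R * R) => S p.2 (w0n n) p.1) (fun p : plane R * R => S p.2 w0 p.1)
  (@leb2_sigma_finite R) A0.
apply: key.
- by move=> n; case: (yudovich_bounded (soln n)).
- by case: (yudovich_bounded sol).
- move=> n t; have [_ vnA _] := hvn n.
  exact: (yudovich_ess_bounded t (soln n) (wvn n) vnA).
- by move=> t; exact: (yudovich_ess_bounded t sol wv vA).
- exact: fixed.
Qed.
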